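(* Let $(M,\boldsymbol g)$ be a maximally symmetric space of dimension $n$ with curvature constant $\lambda\neq0$, i.e. $R_{abcd}=\lambda(g_{ac}g_{bd}-g_{ad}g_{bc})$. Then every conformal Killing-Yano tensor $\boldsymbol Y$ of order $p\ge2$ on $M$ can be decomposed as $\boldsymbol Y=\boldsymbol A+\boldsymbol H$, where $\boldsymbol A$ is a Killing-Yano tensor of order $p$ and $\boldsymbol H$ is a closed conformal Killing-Yano tensor of order $p$.
   Context: The metric has arbitrary signature, $\nabla$ is its Levi-Civita connection, and square brackets denote normalized (weight one) antisymmetrization. A maximally symmetric space of dimension $n$ is one admitting $\frac12n(n+1)$ independent Killing vector fields; its Riemann tensor has the form $R_{abcd}=\lambda(g_{ac}g_{bd}-g_{ad}g_{bc})$ with $\lambda$ a constant. A totally skew-symmetric tensor $\boldsymbol Y$ of rank $p$ is a conformal Killing-Yano tensor of order $p$ if there is a skew-symmetric tensor $\boldsymbol h$ of rank $p-1$ such that $$\nabla_a Y_{b_1b_2\cdots b_p}+\nabla_{b_1}Y_{ab_2\cdots b_p}=2g_{a[b_1}h_{b_2\cdots b_p]}+2g_{b_1[a}h_{b_2\cdots b_p]},$$ equivalently $\nabla_aY_{b_1\cdots b_p}=\nabla_{[a}Y_{b_1\cdots b_p]}+2g_{a[b_1}h_{b_2\cdots b_p]}$. It is a Killing-Yano tensor if $\boldsymbol h=0$, and a closed conformal Killing-Yano tensor if $\nabla_{[a}Y_{b_1\cdots b_p]}=0$. *)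

(* Defs.v *)
From HB Require Import structures.
From mathcomp Require Import all_boot all_order all_fingroup all_algebra.
From mathcomp Require Import all_classical all_reals all_analysis.
From mathcomp Require Import ring.

Set Implicit Arguments.
Unset Strict Implicit.
Unset Printing Implicit Defensive.

Import Order.TTheory GRing.Theory Num.Theory.
Import numFieldNormedType.Exports.

Local Open Scope classical_set_scope.
Local Open Scope ring_scope.

Section Smooth.
Variables (R : realType) (n : nat).
Implicit Types (f : 'rV[R]_n -> R) (U : set 'rV[R]_n).

Definition pderiv (k : 'I_n) f : 'rV[R]_n -> R :=
  fun y => 'D_(delta_mx 0 k) f y.

(* C^oo on the open set U: partial derivatives of every order exist and are
   continuous at every point of U. *)
Definition smooth_on U f : Prop :=
  forall s : seq 'I_n, let h := foldr pderiv f s in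
  forall y, U y ->
    {for y, continuous h} /\ forall k : 'I_n, derivable h y (delta_mx 0 k).

End Smooth.

(* chart_inv i is only meaningful on the image of chart_dom i. *)
Record smooth_manifold (R : realType) (n : nat) := SmoothManifold {
  points :> topologicalType;
  points_hausdorff : hausdorff_space points;
  points_second_countable : @second_countable points;
  chart_index : Type;
  chart_dom : chart_index -> set points;
  chart : chart_index -> points -> 'rV[R]_n;
  chart_inv : chart_index -> 'rV[R]_n -> points;
  chart_cover : forall x, exists i, chart_dom i x;
  chart_dom_open : forall i, open (chart_dom i);
  chart_img_open : forall i, open (chart i @` chart_dom i);
  chartK : forall i x, chart_dom i x -> chart_inv i (chart i x) = x;
  chart_continuous :
    forall i x, chart_dom i x -> {for x, continuous (chart i)};
  chart_inv_continuous :
    forall i y, (chart i @` chart_dom i) y -> {for y, continuous (chart_inv i)};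
  chart_transition : forall i j (k : 'I_n),
    smooth_on (chart i @` (chart_dom i `&` chart_dom j))
      (fun y => chart j (chart_inv i y) 0 k)
}.

Section Tensors.
Variables (R : realType) (n : nat) (M : smooth_manifold R n).
Implicit Types (i j : chart_index M) (x : M).

Definition smooth_in_chart i (f : M -> R) : Prop :=
  smooth_on (chart i @` chart_dom i) (f \o chart_inv i).

(* The partial derivative of f with respect to the k-th coordinate of chart i. *)
Definition dcoord i (k : 'I_n) (f : M -> R) : M -> R :=
  fun x => pderiv k (f \o chart_inv i) (chart i x).

(* d (coordinate k of chart j) / d (coordinate l of chart i) *)
Definition jacobian i j x (k l : 'I_n) : R :=
  dcoord i l (fun z => chart j z 0 k) x.

(* T i b x is the component of index b = (b_1, ..., b_p), in chart i, at x, of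
   an object with p lower indices; it is only meaningful for x in chart_dom i. *)
Definition components (p : nat) :=
  chart_index M -> {ffun 'I_p -> 'I_n} -> M -> R.

Record ctensor (p : nat) := CTensor {
  ctensor_comp :> chart_index M -> {ffun 'I_p -> 'I_n} -> M -> R;
  ctensor_smooth : forall i b, smooth_in_chart i (ctensor_comp i b);
  ctensor_law : forall i j x, chart_dom i x -> chart_dom j x ->
    forall b, ctensor_comp i b x =
      \sum_(c : {ffun 'I_p -> 'I_n})
        (\prod_(k < p) jacobian i j x (c k) (b k)) * ctensor_comp j c x
}.

Record vector_field := VectorField {
  vfield_comp :> chart_index M -> 'I_n -> M -> R;
  vfield_smooth : forall i a, smooth_in_chart i (vfield_comp i a);
  vfield_law : forall i j x, chart_dom i x -> chart_dom j x ->
    forall a, vfield_comp j a x =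
      \sum_(b < n) jacobian i j x a b * vfield_comp i b x
}.

(* (a, b_1, ..., b_p) *)
Definition icons p (a : 'I_n) (b : {ffun 'I_p -> 'I_n}) :
    {ffun 'I_p.+1 -> 'I_n} :=
  [ffun k => if unlift ord0 k is Some l then b l else a].

(* (b_2, ..., b_p) *)
Definition itail p (b : {ffun 'I_p.+1 -> 'I_n}) : {ffun 'I_p -> 'I_n} :=
  [ffun k => b (lift ord0 k)].

Definition isubst p (b : {ffun 'I_p -> 'I_n}) (r : 'I_p) (c : 'I_n) :
    {ffun 'I_p -> 'I_n} :=
  [ffun k => if k == r then c else b k].

Definition iperm p (b : {ffun 'I_p -> 'I_n}) (s : 'S_p) : {ffun 'I_p -> 'I_n} :=
  [ffun k => b (s k)].

Definition index1 (a : 'I_n) : {ffun 'I_1 -> 'I_n} := [ffun=> a].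
Definition index2 (a b : 'I_n) := icons a (index1 b).

(* F_[b_1 ... b_p] *)
Definition antisym p (F : {ffun 'I_p -> 'I_n} -> R) (b : {ffun 'I_p -> 'I_n}) : R :=
  (p`!%:R)^-1 * \sum_(s : 'S_p) (-1) ^+ s * F (iperm b s).

Definition skew_symmetric p (T : ctensor p) : Prop :=
  forall i x, chart_dom i x ->
  forall b (s : 'S_p), T i (iperm b s) x = (-1) ^+ s * T i b x.

End Tensors.

Section Metrics.
Variables (R : realType) (n : nat) (M : smooth_manifold R n).

Record metric_tensor := MetricTensor {
  metric_ctensor :> ctensor M 2;
  metric_ctensor_sym : forall i x, chart_dom i x -> forall a b,
    metric_ctensor i (index2 a b) x = metric_ctensor i (index2 b a) x;
  metric_ctensor_nondegenerate : forall i x, chart_dom i x ->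
    \matrix_(a, b) metric_ctensor i (index2 a b) x \in unitmx
}.

Variable g : metric_tensor.
Implicit Types (i : chart_index M) (x : M).

Definition gdown i (a b : 'I_n) : M -> R := g i (index2 a b).

Definition gup i (a b : 'I_n) : M -> R :=
  fun x => invmx (\matrix_(c, d) gdown i c d x) a b.

(* christoffel i c a b is Gamma^c_{ab} *)
Definition christoffel i (c a b : 'I_n) : M -> R := fun x =>
  2^-1 * \sum_(d < n) gup i c d x *
    (dcoord i a (gdown i b d) x + dcoord i b (gdown i a d) x
     - dcoord i d (gdown i a b) x).

(* The first of the p+1 indices of nabla T is the differentiation index. *)
Definition nabla p (T : components M p) : components M p.+1 := fun i ab x =>
  let a := ab ord0 in
  let b := itail ab in
  dcoord i a (T i b) x
  - \sum_(r < p) \sum_(c < n) christoffel i c a (b r) x * T i (isubst b r c) x.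

(* nabla is the Levi-Civita connection of g: it is torsion-free
   (christoffel_sym) and metric (nabla_metric). *)
Lemma eq_dcoord i k (f1 f2 : M -> R) x : chart_dom i x ->
  (forall z, chart_dom i z -> f1 z = f2 z) -> dcoord i k f1 x = dcoord i k f2 x.
Proof.
move=> xi f12; rewrite /dcoord /pderiv; apply: near_eq_derive => /=.
have : nbhs (chart i x) (chart i @` chart_dom i).
  by apply: open_nbhs_nbhs; split; [exact: chart_img_open | exists x].
by apply: filterS => _ [z zi <-] /=; rewrite chartK// f12.
Qed.

Lemma dcoord_gdown_sym i x k a b : chart_dom i x ->
  dcoord i k (gdown i a b) x = dcoord i k (gdown i b a) x.
Proof. by move=> xi; apply: eq_dcoord => // z zi; rewrite /gdown metric_ctensor_sym. Qed.

Lemma christoffel_sym i x c a b : chart_dom i x ->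
  christoffel i c a b x = christoffel i c b a x.
Proof.
move=> xi; congr (_ * _); apply: eq_bigr => d _.
by rewrite (dcoord_gdown_sym d a b xi) [X in _ * (X - _)]addrC.
Qed.

Lemma gdown_christoffel i x e a b : chart_dom i x ->
  \sum_(c < n) gdown i e c x * christoffel i c a b x =
  2^-1 * (dcoord i a (gdown i b e) x + dcoord i b (gdown i a e) x
          - dcoord i e (gdown i a b) x).
Proof.
move=> xi; pose G : 'M[R]_n := \matrix_(c, d) gdown i c d x.
pose v : 'cV[R]_n := \col_d (dcoord i a (gdown i b d) x
  + dcoord i b (gdown i a d) x - dcoord i d (gdown i a b) x).
have Gv : G *m (2^-1 *: (invmx G *m v)) = 2^-1 *: v.
  by rewrite -scalemxAr mulKVmx// metric_ctensor_nondegenerate.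
move/matrixP/(_ e 0) : Gv; rewrite !mxE => <-.
apply: eq_bigr => c _; rewrite !mxE; congr (_ * (_ * _)).
by apply: eq_bigr => d _; rewrite !mxE.
Qed.

Lemma nabla_metric i x abc : chart_dom i x -> nabla g i abc x = 0.
Proof.
move=> xi; rewrite /nabla.
have eb (b : {ffun 'I_2 -> 'I_n}) : b = index2 (b ord0) (b (lift ord0 ord0)).
  apply/ffunP => k; rewrite !ffunE; case: unliftP => [l ->|->//].
  by rewrite ffunE (ord1 l).
rewrite [itail abc]eb.
set a := abc ord0; set b := itail abc ord0; set c := itail abc _.
rewrite big_ord_recl big_ord1.
have e0 d : isubst (index2 b c) ord0 d = index2 d c.
  apply/ffunP => k; rewrite !ffunE; case: unliftP => [l ->|->//].
  by rewrite eq_sym (negPf (neq_lift _ _)) ffunE.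
have e1 d : isubst (index2 b c) (lift ord0 ord0) d = index2 b d.
  apply/ffunP => k; rewrite !ffunE; case: unliftP => [l ->|->//].
  by rewrite (ord1 l) eqxx ffunE.
under eq_bigr => d _ do
  rewrite e0 ffunE unlift_none metric_ctensor_sym// mulrC.
under [X in _ - (_ + X)]eq_bigr => d _ do
  rewrite e1 ffunE liftK ffunE mulrC.
rewrite !gdown_christoffel//.
rewrite (dcoord_gdown_sym _ c b xi).
set A := dcoord i a _ x; set B := dcoord i b _ x; set C := dcoord i c _ x.
rewrite -/(gdown i b c); by field.
Qed.

(* riemann_up i a b c d is R^a_{bcd}, with the sign convention
   (nabla_c nabla_d - nabla_d nabla_c) X^a = R^a_{bcd} X^b *)
Definition riemann_up i (a b c d : 'I_n) : M -> R := fun x =>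
  dcoord i c (christoffel i a d b) x - dcoord i d (christoffel i a c b) x
  + \sum_(e < n) (christoffel i a c e x * christoffel i e d b x
                  - christoffel i a d e x * christoffel i e c b x).

Definition riemann i (a b c d : 'I_n) : M -> R := fun x =>
  \sum_(e < n) gdown i a e x * riemann_up i e b c d x.

Definition curvature_constant (lam : R) : Prop :=
  forall i x, chart_dom i x -> forall a b c d,
    riemann i a b c d x =
    lam * (gdown i a c x * gdown i b d x - gdown i a d x * gdown i b c x).

Definition lower (X : vector_field M) : components M 1 := fun i b x =>
  \sum_(a < n) gdown i (b ord0) a x * X i a x.

Definition killing (X : vector_field M) : Prop :=
  forall i x, chart_dom i x -> forall a b,
    nabla (lower X) i (index2 a b) x + nabla (lower X) i (index2 b a) x = 0.

(* Linear independence is over the constants R. *)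
Definition independent_fields m (X : 'I_m -> vector_field M) : Prop :=
  forall c : 'I_m -> R,
    (forall i x, chart_dom i x -> forall a, \sum_(k < m) c k * X k i a x = 0) ->
    forall k, c k = 0.

Definition maximally_symmetric : Prop :=
  exists X : 'I_((n * n.+1) %/ 2) -> vector_field M,
    (forall k, killing (X k)) /\ independent_fields X.

(* 2 g_{a[b_1} h_{b_2 ... b_p]}, p = q + 1 *)
Definition g_wedge q (h : ctensor M q) i (a : 'I_n)
    (b : {ffun 'I_q.+1 -> 'I_n}) (x : M) : R :=
  2 * antisym (fun c => gdown i a (c ord0) x * h i (itail c) x) b.

Definition conformal_killing_yano_with q (Y : ctensor M q.+1) (h : ctensor M q) :
    Prop :=
  [/\ skew_symmetric Y, skew_symmetric h &
    forall i x, chart_dom i x -> forall a b1 (b : {ffun 'I_q -> 'I_n}),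
      nabla Y i (icons a (icons b1 b)) x + nabla Y i (icons b1 (icons a b)) x =
      g_wedge h i a (icons b1 b) x + g_wedge h i b1 (icons a b) x].

Definition conformal_killing_yano q (Y : ctensor M q.+1) : Prop :=
  exists h : ctensor M q, conformal_killing_yano_with Y h.

Definition killing_yano q (Y : ctensor M q.+1) : Prop :=
  exists h : ctensor M q, conformal_killing_yano_with Y h /\
    forall i x, chart_dom i x -> forall b, h i b x = 0.

Definition closed_conformal_killing_yano q (Y : ctensor M q.+1) : Prop :=
  conformal_killing_yano Y /\
  forall i x, chart_dom i x -> forall ab,
    antisym (fun cd => nabla Y i cd x) ab = 0.

End Metrics.

(* Main.v *)
Require Import Defs.
From mathcomp Require Import all_boot all_order all_fingroup all_algebra.
From mathcomp Require Import all_classical all_reals all_analysis.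
From mathcomp Require Import ring.

(* Let p = q + 1 and let W_{a|b1...bp}[h] be the sum, with alternating signs, of
   g_{a b_r} h_{b_1 .. omit b_r .. b_p}, so that 2 g_{a[b_1} h_{b_2...b_p]} is
   (2/p) W[h].  A conformal Killing-Yano tensor satisfies nabla Y = K + (2/p) W[h]
   with K totally skew.  Inserting this in the Ricci identity for Y and contracting
   the skew K away shows, when n > p, that h has no divergence and that nabla h is
   totally skew.  The Ricci identity for h then gives
   nabla_c nabla_a h_b = - lam W_{c|ab}[h]: the difference of the two sides is
   symmetric in c, a and skew in a, b_1.  Hence H = - (2/(p lam)) nabla h is closed
   and conformal Killing-Yano with the same h as Y, and A = Y - H is Killing-Yano.
   Since nabla h is totally skew it equals its antisymmetrization, where the
   Christoffel symbols cancel; so H is an exterior derivative, which makes it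
   a smooth tensor.  When n <= p every p-form is closed and one takes A = 0. *)

Set Implicit Arguments.
Unset Strict Implicit.
Unset Printing Implicit Defensive.

Import Order.TTheory GRing.Theory Num.Theory.
Import numFieldNormedType.Exports.

Local Open Scope classical_set_scope.
Local Open Scope ring_scope.

(** * Multi-indices and antisymmetrization *)

Section MultiIndices.
Variables (n : nat).
Local Notation idx p := {ffun 'I_p -> 'I_n}.

Lemma icons0 p a (b : idx p) : icons a b ord0 = a.
Proof. by rewrite ffunE unlift_none. Qed.

Lemma iconsS p a (b : idx p) r : icons a b (lift ord0 r) = b r.
Proof. by rewrite ffunE liftK. Qed.

Lemma itail_icons p a (b : idx p) : itail (icons a b) = b.
Proof. by apply/ffunP => k; rewrite ffunE iconsS. Qed.

Lemma icons_itail p (b : idx p.+1) : icons (b ord0) (itail b) = b.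
Proof. by apply/ffunP => k; rewrite ffunE; case: unliftP => [l|] ->; rewrite ?ffunE. Qed.

Lemma isubst_same p (b : idx p) r c : isubst b r c r = c.
Proof. by rewrite ffunE eqxx. Qed.

Lemma isubst_neq p (b : idx p) r c k : k != r -> isubst b r c k = b k.
Proof. by rewrite ffunE => /negPf->. Qed.

Lemma isubst_id p (b : idx p) r : isubst b r (b r) = b.
Proof. by apply/ffunP => k; rewrite ffunE; case: eqP => // ->. Qed.

Lemma isubst_isubst p (b : idx p) r c d :
  isubst (isubst b r c) r d = isubst b r d.
Proof. by apply/ffunP => k; rewrite !ffunE; case: eqP. Qed.

Lemma isubstC p (b : idx p) r s c d : r != s ->
  isubst (isubst b r c) s d = isubst (isubst b s d) r c.
Proof.
by move=> rs; apply/ffunP => k; rewrite !ffunE; case: eqP => // ->; rewrite eq_sym (negPf rs).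
Qed.

Lemma isubst_icons0 p a (b : idx p) c : isubst (icons a b) ord0 c = icons c b.
Proof.
apply/ffunP => k; case: (unliftP ord0 k) => [l|] ->; last by rewrite isubst_same icons0.
by rewrite isubst_neq ?iconsS// eq_sym neq_lift.
Qed.

Lemma isubst_iconsS p a (b : idx p) r c :
  isubst (icons a b) (lift ord0 r) c = icons a (isubst b r c).
Proof.
apply/ffunP => k; case: (unliftP ord0 k) => [l|] ->; last first.
  by rewrite isubst_neq ?neq_lift// !icons0.
by rewrite iconsS [LHS]ffunE [RHS]ffunE (inj_eq lift_inj) iconsS.
Qed.

Lemma itail_isubst0 p (b : idx p.+1) c : itail (isubst b ord0 c) = itail b.
Proof. by apply/ffunP => k; rewrite !ffunE. Qed.

Lemma itail_isubstS p (b : idx p.+1) r c :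
  itail (isubst b (lift ord0 r) c) = isubst (itail b) r c.
Proof. by rewrite -{1}[b]icons_itail isubst_iconsS itail_icons. Qed.

Lemma iperm1 p (b : idx p) : iperm b 1 = b.
Proof. by apply/ffunP => k; rewrite ffunE perm1. Qed.

Lemma iperm_iperm p (b : idx p) s t : iperm (iperm b s) t = iperm b (t * s).
Proof. by apply/ffunP => k; rewrite !ffunE permM. Qed.

Lemma iperm_isubst p (b : idx p) s r c :
  isubst (iperm b s) r c = iperm (isubst b (s r) c) s.
Proof. by apply/ffunP => k; rewrite !ffunE (inj_eq perm_inj). Qed.

Lemma iperm_tperm p (b : idx p) u v :
  iperm b (tperm u v) = isubst (isubst b u (b v)) v (b u).
Proof.
apply/ffunP => k; rewrite !ffunE; case: tpermP => [->|->|/eqP ku /eqP kv].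
- by rewrite eqxx; case: eqP => // ->.
- by rewrite eqxx.
- by rewrite (negPf ku) (negPf kv).
Qed.

(** The exchange of the head with a tail entry is put in the same substitution form as the terms of
    [wedge], so that skewness can be used as a rewriting rule without moving indices past one
    another. *)
Lemma iperm_icons_tperm0 p a (b : idx p) r :
  iperm (icons a b) (tperm ord0 (lift ord0 r)) = icons (b r) (isubst b r a).
Proof. by rewrite iperm_tperm icons0 iconsS isubst_icons0 isubst_iconsS. Qed.

Lemma iperm_icons_lift p a (b : idx p) s :
  iperm (icons a b) (lift_perm ord0 ord0 s) = icons a (iperm b s).
Proof.
apply/ffunP => k; case: (unliftP ord0 k) => [l|] ->.
  by rewrite iconsS !ffunE lift_perm_lift liftK.
by rewrite icons0 ffunE lift_perm_id icons0.
Qed.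

Lemma lift_tperm p (u v : 'I_p) :
  lift_perm ord0 ord0 (tperm u v) = tperm (lift ord0 u) (lift ord0 v).
Proof.
apply/permP => k; case: (unliftP ord0 k) => [l|] ->.
  rewrite lift_perm_lift; case: (tpermP u v l) => [->|->|/eqP lu /eqP lv].
  - by rewrite tpermL.
  - by rewrite tpermR.
  - by rewrite tpermD ?(inj_eq lift_inj)// eq_sym.
by rewrite lift_perm_id tpermD// eq_sym neq_lift.
Qed.

(** Coset decomposition of the symmetric group by the stabilizer of the first position: [u] is the
    image of that position, and [u = ord0] gives the trivial coset. Injectivity suffices, as both
    sides have (p+1)! elements. *)
Lemma lift_perm_tperm_bij p :
  bijective (fun ut : 'I_p.+1 * 'S_p =>
    (lift_perm ord0 ord0 ut.2 * tperm ord0 ut.1 : 'S_p.+1)%g).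
Proof.
apply: inj_card_bij; last first.
  by rewrite card_prod card_ord !card_Sn factS.
move=> [u s] [v t] /= e.
have uv : u = v.
  by move/permP: e => /(_ ord0); rewrite !permM !lift_perm_id !tpermL.
congr pair => //; move: e; rewrite uv => /mulIg/permP e; apply/permP => k.
by move: (e (lift ord0 k)); rewrite !lift_perm_lift => /lift_inj.
Qed.

End MultiIndices.

(** * Skew functions of a multi-index and normalized antisymmetrization *)

Section Antisymmetrization.
Variables (R : realType) (n : nat).
Local Notation idx p := {ffun 'I_p -> 'I_n}.

(** This is what [skew_symmetric] says in one chart at one point; the algebra below then deals with
    bare functions of a multi-index. *)
Definition skewsym p (F : idx p -> R) :=
  forall b (s : 'S_p), F (iperm b s) = (-1) ^+ s * F b.

(** Transpositions generate the symmetric group, and each contributes one sign. *)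
Lemma tperm_skewsym p (F : idx p -> R) :
  (forall b u v, u != v -> F (iperm b (tperm u v)) = - F b) -> skewsym F.
Proof.
move=> Ftperm b s; have [ts -> dts] := prod_tpermP s; elim: ts dts => [|[u v] ts IH] /=.
  by rewrite big_nil odd_perm1 iperm1 mul1r.
move=> /andP[uv dts]; rewrite big_cons -iperm_iperm Ftperm// IH//.
by rewrite odd_permM odd_tperm uv signr_addb mulN1r mulNr.
Qed.

Lemma skewsym_tperm p (F : idx p -> R) b u v :
  skewsym F -> u != v -> F (iperm b (tperm u v)) = - F b.
Proof. by move=> altF uv; rewrite altF odd_tperm uv mulN1r. Qed.

Lemma skewsym_swap p (F : idx p -> R) b u v c d : skewsym F -> u != v ->
  F (isubst (isubst b u c) v d) = - F (isubst (isubst b u d) v c).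
Proof.
move=> altF uv; rewrite -(skewsym_tperm _ altF uv) iperm_tperm.
rewrite isubst_same isubst_neq// isubst_same; congr F.
by apply/ffunP => k; rewrite !ffunE; case: (k == v) => //; case: (k == u).
Qed.

(** A transposition either fixes the first position or exchanges it with a later one; the two
    hypotheses treat these two cases. *)
Lemma skewsym_icons p (F : idx p.+1 -> R) :
  (forall a, skewsym (fun b => F (icons a b))) ->
  (forall a (b : idx p) r, F (icons (b r) (isubst b r a)) = - F (icons a b)) ->
  skewsym F.
Proof.
move=> altF F0; apply: tperm_skewsym => b u v.
rewrite -[b]icons_itail; set a := b ord0; set c := itail b.
case: (unliftP ord0 u) => [u'|] ->; case: (unliftP ord0 v) => [v'|] -> uv.
- rewrite -lift_tperm iperm_icons_lift.
  by rewrite (skewsym_tperm _ (altF a)).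
- by rewrite tpermC iperm_icons_tperm0 F0.
- by rewrite iperm_icons_tperm0 F0.
- by rewrite eqxx in uv.
Qed.

Lemma antisym_skewsym p (F : idx p -> R) : skewsym (antisym F).
Proof.
move=> b s; rewrite /antisym mulrCA; congr (_ * _).
rewrite mulr_sumr [RHS](reindex_inj (mulIg s)); apply: eq_bigr => t _ /=.
by rewrite iperm_iperm odd_permM signr_addb -mulrA mulrCA signrMK.
Qed.

Lemma skewsym_antisym p (F : idx p -> R) b : skewsym F -> antisym F b = F b.
Proof.
move=> altF; rewrite /antisym.
under eq_bigr do rewrite altF signrMK.
by rewrite sumr_const card_Sn -[F b *+ _]mulr_natl mulKf//.
Qed.

Lemma eq_antisym p (F G : idx p -> R) b : F =1 G -> antisym F b = antisym G b.
Proof. by move=> FG; congr (_ * _); apply: eq_bigr => s _; rewrite FG. Qed.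

Lemma antisymD p (F G : idx p -> R) b :
  antisym (fun c => F c + G c) b = antisym F b + antisym G b.
Proof.
by rewrite /antisym -mulrDr -big_split; congr (_ * _); apply: eq_bigr => s _; rewrite mulrDr.
Qed.

Lemma antisymZ p k (F : idx p -> R) b :
  antisym (fun c => k * F c) b = k * antisym F b.
Proof.
rewrite /antisym mulrCA; congr (_ * _); rewrite mulr_sumr.
by apply: eq_bigr => s _; rewrite mulrCA.
Qed.

Lemma antisymN p (F : idx p -> R) b : antisym (fun c => - F c) b = - antisym F b.
Proof. by rewrite -mulN1r -antisymZ; apply: eq_antisym => c; rewrite mulN1r. Qed.

Lemma antisym_sum p (I : finType) (P : pred I) (F : I -> idx p -> R) b :
  antisym (fun c => \sum_(k | P k) F k c) b = \sum_(k | P k) antisym (F k) b.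
Proof.
rewrite /antisym -mulr_sumr exchange_big; congr (_ * _).
by apply: eq_bigr => s _; rewrite mulr_sumr.
Qed.

(** Composing with the transposition reverses every sign and keeps every value, so the sum is its
    own opposite. All later cancellations by symmetry (of the metric, the Christoffel symbols,
    second derivatives) go through this. *)
Lemma antisym_eq0 p (F : idx p -> R) b u v : u != v ->
  (forall c, F (iperm c (tperm u v)) = F c) -> antisym F b = 0.
Proof.
move=> uv Fuv; rewrite /antisym; set S := \sum_s _.
suff SN : S = - S.
  have /eqP : S *+ 2 = 0 by rewrite mulr2n {1}SN addNr.
  by rewrite mulrn_eq0 /= => /eqP->; rewrite mulr0.
rewrite {1}/S (reindex_inj (mulgI (tperm u v))) -sumrN; apply: eq_bigr => s _ /=.
by rewrite -iperm_iperm Fuv odd_permM odd_tperm uv signr_addb mulN1r mulNr.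
Qed.

(** By the pigeonhole principle some index value is repeated, and exchanging its two occurrences
    changes the sign but not the multi-index. *)
Lemma skewsym_eq0 p (F : idx p -> R) b : skewsym F -> (n < p)%N -> F b = 0.
Proof.
move=> altF np; have /injectivePn[u [v uv buv]] : ~~ injectiveb b.
  by apply: contraL np => /injectiveP /leq_card; rewrite !card_ord leqNgt.
have /eqP : F b *+ 2 = 0.
  rewrite mulr2n -{1}[F b]opprK -(skewsym_tperm b altF uv) iperm_tperm buv.
  by rewrite -{1}buv !isubst_id addNr.
by rewrite mulrn_eq0 /= => /eqP.
Qed.

(* Expansion of g_{a[b_1} h_{b_2 ... b_p]}; substituting b_1 for b_r, rather than
   deleting b_r, absorbs the skewsym signs. *)
Lemma antisym_wedge q (G : 'I_n -> R) (h : idx q -> R) b1 (b : idx q) :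
  skewsym h ->
  antisym (fun c => G (c ord0) * h (itail c)) (icons b1 b) =
  q.+1%:R^-1 * (G b1 * h b - \sum_(r < q) G (b r) * h (isubst b r b1)).
Proof.
move=> alth; rewrite /antisym.
rewrite (reindex _ (onW_bij _ (lift_perm_tperm_bij q))) /=.
rewrite -(pair_bigA _ (fun u (s : 'S_q) =>
  (-1) ^+ (lift_perm ord0 ord0 s * tperm ord0 u)%g * (
   G (iperm (icons b1 b) (lift_perm ord0 ord0 s * tperm ord0 u)%g ord0) *
   h (itail (iperm (icons b1 b) (lift_perm ord0 ord0 s * tperm ord0 u)%g))))) /=.
(* The sign of a permutation of the tail cancels against the skewness of [h], so the q! terms with
   the same [u] coincide; q!/(q+1)! leaves the factor 1/(q+1). *)
have term c (s : 'S_q) e : (-1) ^+ (lift_perm ord0 ord0 s * e)%g * (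
   G (iperm c (lift_perm ord0 ord0 s * e)%g ord0) *
   h (itail (iperm c (lift_perm ord0 ord0 s * e)%g))) =
   (-1) ^+ e * (G (iperm c e ord0) * h (itail (iperm c e))).
  rewrite -iperm_iperm -[iperm c e]icons_itail iperm_icons_lift !icons0 !itail_icons.
  rewrite alth odd_permM odd_lift_perm /= signr_addb.
  by rewrite -mulrA mulrCA [G _ * (_ * _)]mulrCA signrMK.
under eq_bigr => u _ do [under eq_bigr => s _ do rewrite term;
  rewrite sumr_const card_Sn -mulr_natl].
rewrite -mulr_sumr factS natrM invfM -mulrA mulKf//.
rewrite big_ord_recl tperm1 odd_perm1 iperm1 mul1r icons0 itail_icons.
congr (_ * (_ + _)); rewrite -sumrN; apply: eq_bigr => r _.
by rewrite odd_tperm neq_lift mulN1r iperm_icons_tperm0 icons0 itail_icons.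
Qed.

End Antisymmetrization.

(** * Curvature identities at a point *)

Section Pointwise.
Variables (R : realType) (n : nat).
Local Notation idx p := {ffun 'I_p -> 'I_n}.

(** For skew [h] this is q+1 times $G_{a[b_1}h_{b_2\cdots b_{q+1}]}$, by [antisym_wedge]: the
    expression W of the overview, freed of its normalization. *)
Definition wedge (G : 'I_n -> 'I_n -> R) q (h : idx q -> R) a b1 (b : idx q) : R :=
  G a b1 * h b - \sum_(r < q) G a (b r) * h (isubst b r b1).

Variables (G U : 'I_n -> 'I_n -> R).
Hypothesis Gsym : forall a b, G a b = G b a.

(** Every term carries [G] with both of its indices antisymmetrized. This is what makes the tensor H
    closed. *)
Lemma antisym_sym_wedge q (h : idx q -> R) (b : idx q.+2) :
  antisym (fun c => wedge G h (c ord0) (c (lift ord0 ord0)) (itail (itail c))) b = 0.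
Proof.
rewrite (antisymD _ _ b) (@antisym_eq0 _ _ _ _ _ ord0 (lift ord0 ord0)) ?neq_lift//; last first.
  move=> c; rewrite -[c]icons_itail -[itail c]icons_itail; set a := c ord0.
  set a1 := itail c ord0; set d := itail _.
  by rewrite iperm_icons_tperm0 !icons0 isubst_icons0 !itail_icons iconsS icons0
    iconsS icons0 Gsym.
rewrite add0r antisymN antisym_sum big1 ?oppr0// => r _.
apply: (@antisym_eq0 _ _ _ _ _ ord0 (lift ord0 (lift ord0 r))); rewrite ?neq_lift// => c.
rewrite -[c]icons_itail -[itail c]icons_itail; set a := c ord0.
set a1 := itail c ord0; set d := itail _.
rewrite iperm_icons_tperm0 iconsS isubst_iconsS !icons0 !itail_icons !iconsS !icons0.
by rewrite isubst_same isubst_isubst Gsym.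
Qed.

(* The difference of the two sides is symmetric in c, a and skew in a, b_1. *)
Lemma wedge_of_commutator q (lam : R) (h : idx q -> R) (T : 'I_n -> idx q.+1 -> R) :
  (0 < q)%N -> skewsym h -> (forall c, skewsym (T c)) ->
  (forall c a (b : idx q), T c (icons a b) - T a (icons c b) =
    lam * \sum_(r < q) (G (b r) c * h (isubst b r a) - G (b r) a * h (isubst b r c))) ->
  forall c a (b : idx q), T c (icons a b) = - lam * wedge G h c a b.
Proof.
(* With q > 0 the multi-index [b] has a first entry, in which the skewness can be exploited. *)
case: q h T => // q h T _ alth altT comm c a b.
(* [S] is the difference of the two sides. Its symmetry in the first two indices restates the
   commutator hypothesis. *)
pose S c a b := T c (icons a b) + lam * wedge G h c a b.
have Ssym x y z : S x y z = S y x z.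
  apply/eqP; rewrite -subr_eq0; apply/eqP.
  have := comm x y z; rewrite /S /wedge sumrB (Gsym y x) => e.
  rewrite [X in _ * (_ - X)](eq_bigr (fun r => G (z r) x * h (isubst z r y))); last first.
    by move=> r _; rewrite Gsym.
  rewrite [X in _ - (_ + _ * (_ - X))](eq_bigr (fun r => G (z r) y * h (isubst z r x))); last first.
    by move=> r _; rewrite Gsym.
  move/eqP: e; rewrite subr_eq => /eqP->; ring.
have Sskew x y z : S x y z = - S x (z ord0) (isubst z ord0 y).
  rewrite /S -[in LHS](icons_itail z) -[isubst z _ _]icons_itail itail_isubst0 isubst_same.
  set w := itail z; set v := z ord0.
  have -> : T x (icons y (icons v w)) = - T x (icons v (icons y w)).
    have := skewsym_tperm (icons v (icons y w)) (altT x) (neq_lift ord0 ord0).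
    by rewrite iperm_icons_tperm0 icons0 isubst_icons0.
  rewrite opprD -mulrN; congr (_ + _ * _).
  rewrite /wedge !big_ord_recl !icons0 !isubst_icons0.
  have -> : \sum_(i < q) G x (icons v w (lift ord0 i)) * h (isubst (icons v w) (lift ord0 i) y)
     = - \sum_(i < q) G x (icons y w (lift ord0 i)) * h (isubst (icons y w) (lift ord0 i) v).
    rewrite -sumrN; apply: eq_bigr => r _; rewrite !iconsS -mulrN; congr (_ * _).
    rewrite -[X in h (isubst X _ _)](isubst_icons0 v) -[in RHS](isubst_icons0 v w y).
    by rewrite (skewsym_swap (icons v w)) ?neq_lift//.
  ring.
have S0 : S c a b = 0.
  (* Only the first entry of [b] varies now. Three symmetric swaps alternating with three skew ones
     restore the order of the three indices with total sign -1. *)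
  have sskew x y z : S x y (isubst b ord0 z) = - S x z (isubst b ord0 y).
    by rewrite Sskew isubst_same isubst_isubst.
  have : S c a b = - S c a b.
    rewrite -{1}(isubst_id b ord0) Ssym sskew Ssym sskew opprK Ssym sskew.
    by rewrite isubst_id.
  by move/eqP; rewrite -addr_eq0 -mulr2n mulrn_eq0 => /eqP.
by apply/eqP; rewrite -subr_eq0 mulNr opprK; apply/eqP.
Qed.

Hypothesis Usym : forall a b, U a b = U b a.
Hypothesis UG : forall a b, \sum_c U a c * G c b = (a == b)%:R.

Definition mtrace (F : 'I_n -> 'I_n -> R) : R := \sum_a \sum_b U a b * F a b.

Lemma eq_mtrace F1 F2 : (forall a b, F1 a b = F2 a b) -> mtrace F1 = mtrace F2.
Proof. by move=> F12; apply: eq_bigr => a _; apply: eq_bigr => b _; rewrite F12. Qed.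

Lemma mtraceD F1 F2 : mtrace (fun a b => F1 a b + F2 a b) = mtrace F1 + mtrace F2.
Proof.
rewrite -big_split; apply: eq_bigr => a _; rewrite -big_split.
by apply: eq_bigr => b _; rewrite mulrDr.
Qed.

Lemma mtraceZ k F : mtrace (fun a b => k * F a b) = k * mtrace F.
Proof.
rewrite mulr_sumr; apply: eq_bigr => a _; rewrite mulr_sumr.
by apply: eq_bigr => b _; rewrite mulrCA.
Qed.

Lemma mtraceN F : mtrace (fun a b => - F a b) = - mtrace F.
Proof. by rewrite -mulN1r -mtraceZ; apply: eq_mtrace => a b; rewrite mulN1r. Qed.

Lemma mtraceB F1 F2 : mtrace (fun a b => F1 a b - F2 a b) = mtrace F1 - mtrace F2.
Proof. by rewrite mtraceD mtraceN. Qed.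

Lemma mtrace_sum (I : finType) (F : I -> 'I_n -> 'I_n -> R) :
  mtrace (fun a b => \sum_k F k a b) = \sum_k mtrace (F k).
Proof.
rewrite /mtrace [RHS]exchange_big; apply: eq_bigr => a _ /=; rewrite [RHS]exchange_big.
by apply: eq_bigr => b _; rewrite mulr_sumr.
Qed.

Lemma mtrace_metric k : mtrace (fun a b => G b a * k) = n%:R * k.
Proof.
rewrite /mtrace; under eq_bigr => a _ do
  [under eq_bigr do rewrite mulrA; rewrite -mulr_suml UG eqxx mul1r].
by rewrite sumr_const card_ord mulr_natl.
Qed.

Lemma mtrace_metricr c (X : 'I_n -> R) : mtrace (fun a b => G b c * X a) = X c.
Proof.
rewrite /mtrace; under eq_bigr => a _ do
  [under eq_bigr do rewrite mulrA; rewrite -mulr_suml UG].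
rewrite (bigD1 c)//= eqxx mul1r big1 ?addr0// => a /negPf->; by rewrite mul0r.
Qed.

Lemma mtraceC F : mtrace (fun a b => F b a) = mtrace F.
Proof.
rewrite /mtrace exchange_big; apply: eq_bigr => a _; apply: eq_bigr => b _.
by rewrite Usym.
Qed.

Lemma mtrace_metricl c (X : 'I_n -> R) : mtrace (fun a b => G a c * X b) = X c.
Proof. by rewrite -mtraceC mtrace_metricr. Qed.

Lemma mtrace_skew F : (forall a b, F a b = - F b a) -> mtrace F = 0.
Proof.
move=> FN; have /eqP : mtrace F = - mtrace F by rewrite -mtraceN -mtraceC; apply: eq_mtrace.
by rewrite -addr_eq0 -mulr2n mulrn_eq0 /= => /eqP.
Qed.


(* Contracting the commutator identity in a, b1 gives
   (n - q - 1) Dh_{c b} + sum_r g_{c b_r} div_r(h)_b = skew in c, b_r;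
   contracting once more gives 2 (n - q) div h = 0. *)
Lemma skew_of_commutator q (lam : R) (Y : idx q.+1 -> R)
    (K : 'I_n -> idx q.+2 -> R) (Dh : 'I_n -> idx q -> R) :
  (q.+1 < n)%N -> skewsym Y -> (forall c, skewsym (K c)) ->
  (forall c, skewsym (Dh c)) ->
  (forall c a b1 (b : idx q),
    (K c (icons a (icons b1 b)) + wedge G (Dh c) a b1 b) -
    (K a (icons c (icons b1 b)) + wedge G (Dh a) c b1 b) =
    lam * \sum_(r < q.+1)
      (G (icons b1 b r) c * Y (isubst (icons b1 b) r a)
       - G (icons b1 b r) a * Y (isubst (icons b1 b) r c))) ->
  forall c (b : idx q) r, Dh (b r) (isubst b r c) = - Dh c b.
Proof.
move=> qn altY altK altDh comm.
(* [V r b] is the divergence of [h] on its r-th slot, the r-th entry of [b] being overwritten. [D]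
   contracts the differentiation index of [K] with $b_1$. *)
pose V r (b : idx q) := mtrace (fun a e => Dh a (isubst b r e)).
pose D c (b : idx q) := mtrace (fun a b1 => K a (icons c (icons b1 b))).
have DN c (b : idx q) r : D (b r) (isubst b r c) = - D c b.
  rewrite /D -mtraceN; apply: eq_mtrace => a b1.
  rewrite -(skewsym_tperm _ (altK a) (neq_lift ord0 (lift ord0 r))).
  by rewrite iperm_icons_tperm0 iconsS isubst_iconsS.
have YN c (b : idx q) r : Y (icons (b r) (isubst b r c)) = - Y (icons c b).
  by rewrite -(skewsym_tperm _ altY (neq_lift ord0 r)) iperm_icons_tperm0.
pose m : R := n%:R - q%:R.
(* First contraction, of a with $b_1$. The trace of [K c] vanishes by skewness, and the right side
   is skew in c and each $b_r$. *)
have main c (b : idx q) : (m - 1) * Dh c b + \sum_(r < q) G c (b r) * V r b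
    = D c b + lam * ((1 - m) * Y (icons c b)).
  have := eq_mtrace (fun a b1 => comm c a b1 b).
  rewrite mtraceB 2!mtraceD mtraceZ.
  rewrite (@mtrace_skew (fun a b1 => K c _)); last first.
    move=> a b1; rewrite -(skewsym_tperm _ (altK c) (neq_lift ord0 ord0)).
    by rewrite iperm_icons_tperm0 icons0 isubst_icons0.
  rewrite -/(D c b).
  have -> : mtrace (fun a b1 => wedge G (Dh c) a b1 b) = m * Dh c b.
    rewrite /wedge mtraceB mtrace_sum.
    rewrite (eq_mtrace (fun a b1 => congr1 (fun k => k * _) (Gsym a b1))) mtrace_metric.
    under eq_bigr => r _ do rewrite (mtrace_metricl (b r) (fun b1 => Dh c (isubst b r b1))) isubst_id.
    by rewrite sumr_const card_ord -[Dh c b *+ q]mulr_natl -mulrBl.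
  have -> : mtrace (fun a b1 => wedge G (Dh a) c b1 b) =
      Dh c b - \sum_(r < q) G c (b r) * V r b.
    rewrite /wedge mtraceB mtrace_sum.
    rewrite (eq_mtrace (fun a b1 => congr1 (fun k => k * _) (Gsym c b1))).
    rewrite (mtrace_metricr c (fun a => Dh a b)); congr (_ - _).
    by apply: eq_bigr => r _; rewrite mtraceZ.
  have -> : mtrace (fun a b1 => \sum_(r < q.+1)
      (G (icons b1 b r) c * Y (isubst (icons b1 b) r a)
       - G (icons b1 b r) a * Y (isubst (icons b1 b) r c))) = (1 - m) * Y (icons c b).
    under eq_mtrace => a b1 do rewrite big_ord_recl icons0 !isubst_icons0.
    rewrite mtraceD mtraceB (mtrace_metricr c (fun a => Y (icons a b))) mtrace_metric.
    rewrite mtrace_sum (eq_bigr (fun=> Y (icons c b))) => [|r _].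
      by rewrite sumr_const card_ord -[Y _ *+ q]mulr_natl /m; ring.
    under eq_mtrace => a b1 do rewrite iconsS !isubst_iconsS.
    rewrite mtraceB mtraceZ mtrace_skew ?mulr0 => [|a b1].
      rewrite sub0r (eq_mtrace (fun a b1 => congr1 (fun k => k * _) (Gsym (b r) a))).
      by rewrite (mtrace_metricl (b r) (fun b1 => Y (icons b1 (isubst b r c)))) YN opprK.
    by rewrite -{1}(isubst_same b r b1) -{1}(isubst_isubst b r b1 a) YN.
  by move=> <-; ring.
(* Second contraction, of c with the r-th entry: the skew right side disappears. On the left [Dh]
   gives (m - 1) V, the term s = r gives n V, and each of the q - 1 others gives -V. The total is 2
   m V, where m = n - q is nonzero. *)
have V0 r b : V r b = 0.
  have : mtrace (fun c e => (m - 1) * Dh c (isubst b r e)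
      + \sum_(s < q) G c (isubst b r e s) * V s (isubst b r e)) = 0.
    rewrite (eq_mtrace (fun c e => main c (isubst b r e))) mtraceD !mtraceZ.
    rewrite !mtrace_skew ?mulr0 ?addr0// => c e.
      by have := YN c (isubst b r e) r; rewrite isubst_same isubst_isubst => ->; rewrite opprK.
    by have := DN c (isubst b r e) r; rewrite isubst_same isubst_isubst => ->; rewrite opprK.
  rewrite mtraceD mtraceZ -/(V r b) mtrace_sum (bigD1 r)//=.
  have -> : mtrace (fun c e => G c (isubst b r e r) * V r (isubst b r e)) = n%:R * V r b.
    rewrite -mtrace_metric; apply: eq_mtrace => c e.
    rewrite isubst_same Gsym; congr (_ * _).
    by apply: eq_mtrace => a f; rewrite isubst_isubst.
  rewrite (eq_bigr (fun=> - V r b)) => [|s sr]; last first.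
    under eq_mtrace => c e do rewrite isubst_neq//.
    rewrite (mtrace_metricl (b s) (fun e => V s (isubst b r e))) /V -mtraceN.
    apply: eq_mtrace => a e; rewrite (skewsym_swap _ _ _ (altDh a)) 1?eq_sym//.
    by rewrite isubstC 1?eq_sym// isubst_id.
  rewrite sumr_const cardC1 card_ord -[_ *+ _.-1]mulr_natl.
  have q0 : (0 < q)%N := leq_ltn_trans (leq0n r) (ltn_ord r).
  rewrite -subn1 natrB// -/(m) => e.
  have : 2 * m * V r b = 0 by rewrite -e /m; ring.
  move/eqP; rewrite !mulf_eq0 pnatr_eq0 /= => /orP[|/eqP//].
  by rewrite /m subr_eq0 eqr_nat => /eqP nq; rewrite nq ltnNge leqnSn in qn.
move=> c b r.
(* Here the strict bound q + 1 < n enters: m - 1 = n - (q + 1). Dividing by it expresses [Dh]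
   through [D] and [Y], both skew in c and $b_r$. *)
have m1 : m - 1 != 0.
  by rewrite /m -addrA -opprD subr_eq0 natr1 eqr_nat; case: ltngtP qn.
have Dhm d (b' : idx q) : Dh d b' = (m - 1)^-1 * (D d b' + lam * ((1 - m) * Y (icons d b'))).
  rewrite -main big1 ?addr0 ?mulKf// => s _; by rewrite V0 mulr0.
by rewrite !Dhm DN YN; ring.
Qed.

End Pointwise.

(** * Partial derivatives: chain rule and symmetry *)

Section PartialDerivatives.
Variable R : realType.

Lemma derivable_line (V : normedModType R) (f : V -> R) (y v : V) (u : R) :
  derivable f (y + u *: v) v ->
  is_derive u 1 (fun u => f (y + u *: v)) ('D_v f (y + u *: v)).
Proof.
move=> df.
have e : (fun h => h^-1 *: (((fun u => f (y + u *: v)) \o shift u) (h *: 1) - f (y + u *: v)))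
   = (fun h => h^-1 *: ((f \o shift (y + u *: v)) (h *: v) - f (y + u *: v))).
  apply/funext => h /=; congr (_ *: (f _ - _)).
  by rewrite [h%:A]mulr1 scalerDl addrCA.
by apply: DeriveDef; rewrite /derivable /derive /= e.
Qed.

(** The step [t] may have either sign, because it will tend to 0 from both sides; hence the bound by
    absolute values. *)
Lemma MVT_line (V : normedModType R) (f : V -> R) (y v : V) (t : R) :
  (forall u : R, `|u| <= `|t| -> derivable f (y + u *: v) v) ->
  exists2 u : R, `|u| <= `|t| & f (y + t *: v) - f y = t * 'D_v f (y + u *: v).
Proof.
move=> df; pose g u := f (y + u *: v).
have dg (u : R) : `|u| <= `|t| -> is_derive u 1 g ('D_v f (y + u *: v)).
  by move=> ut; exact/derivable_line/df.
have MVTg (a b : R) : a <= b -> (forall u, u \in `[a, b]%R -> `|u| <= `|t|) ->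
    exists2 u : R, `|u| <= `|t| & g b - g a = (b - a) * 'D_v f (y + u *: v).
  move=> ab abt.
  have [u uab e] : exists2 u, u \in `[a, b]%R & g b - g a = 'D_v f (y + u *: v) * (b - a).
    apply: MVT_segment => //.
      by move=> u uab; apply/dg/abt; move: uab; rewrite !in_itv /= => /andP[/ltW-> /ltW->].
    apply: derivable_within_continuous => u uab.
    by have [] := dg u (abt _ uab).
  by exists u; [exact: abt | rewrite e mulrC].
have g0 : g 0 = f y by rewrite /g scale0r addr0.
have [t0|t0] := leP 0 t.
  have [|u ut e] := MVTg 0 t t0.
    by move=> u; rewrite in_itv /= => /andP[u0 ut]; rewrite !ger0_norm.
  by exists u => //; rewrite -g0 -[t in RHS]subr0.
have [|u ut e] := MVTg t 0 (ltW t0).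
  by move=> u; rewrite in_itv /= => /andP[tu u0]; rewrite (ler0_norm u0) (ler0_norm (ltW t0)) lerN2.
by exists u => //; rewrite -g0 -[LHS]opprB e sub0r mulNr opprK.
Qed.

(* Mean value theorem along the staircase path from c x to c (h *: v + x). *)
Lemma is_derive_comp_partial (W : normedModType R) n (F : 'rV[R]_n -> R)
    (c : W -> 'rV[R]_n) (x v : W) :
  (\forall z \near c x, forall k, derivable F z (delta_mx 0 k)) ->
  (forall k, {for c x, continuous (pderiv k F)}) ->
  (forall k, derivable (fun w => c w 0 k) x v) ->
  is_derive x v (F \o c) (\sum_k pderiv k F (c x) * 'D_v (fun w => c w 0 k) x).
Proof.
move=> dF cF dc.
pose C h : 'rV[R]_n := c (h *: v + x).
have C0 : C 0 = c x by rewrite /C scale0r add0r.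
pose d k h := C h 0 k - C 0 0 k.
(* Corners of the staircase: the first [m] coordinates are already those of the endpoint, the others
   still those of [c x]. *)
pose z (m : nat) h : 'rV[R]_n := \row_(j < n) (if (j < m)%N then C h 0 j else C 0 0 j).
have zS (k : 'I_n) h : z k.+1 h = z k h + d k h *: delta_mx 0 k.
  apply/rowP => j; rewrite !mxE /d ltnS leq_eqVlt.
  have [->|jk] /= := eqVneq j k; first by rewrite eqxx ltnn mulr1 addrC subrK.
  by rewrite (inj_eq val_inj) (negPf jk) /= mulr0 addr0.
have d_near e : 0 < e -> \forall h \near 0^', forall k, `|d k h| < e.
  move=> e0; apply: filter_forall => k.
  have /derivable1P/derivable1_diffP/differentiable_continuous := dc k.
  move=> /cvgrPdist_lt /(_ _ e0) H; apply: nbhs_dnbhs; move: H.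
  by apply: filterS => h; rewrite scale0r add0r distrC /d C0.
have z_near (P : set 'rV[R]_n) : (\forall w \near c x, P w) ->
    \forall h \near 0^', forall (k : 'I_n) (u : R), `|u| <= `|d k h| -> P (z k h + u *: delta_mx 0 k).
  move=> /nbhs_ballP[e /= e0 eP]; have := d_near _ e0.
  apply: filterS => h dh k u ud; apply: eP; split => // i j; rewrite ord1.
  rewrite -C0 !mxE; have [->|jk] /= := eqVneq j k.
    rewrite ltnn mulr1 /ball /= opprD addrA subrr sub0r normrN.
    exact: le_lt_trans (dh k).
  rewrite mulr0 addr0 /ball /=; case: ifP => _; last by rewrite subrr normr0.
  by rewrite distrC; exact: dh.
have step (k : 'I_n) : h^-1 * (F (z k.+1 h) - F (z k h)) @[h --> 0^'] -->
    pderiv k F (c x) * 'D_v (fun w => c w 0 k) x.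
  (* The slope of [F] along the k-th edge. An edge of length zero gets the expected limit as its
     slope; the factorization [sE] survives, as the increment of [F] is then zero. *)
  pose s h := if d k h == 0 then pderiv k F (c x) else (F (z k.+1 h) - F (z k h)) / d k h.
  have sE h : h^-1 * (F (z k.+1 h) - F (z k h)) = s h * (h^-1 * d k h).
    rewrite /s; case: eqP => [d0|/eqP d0].
      by rewrite zS d0 scale0r addr0 subrr !mulr0.
    by rewrite mulrCA divfK.
  under eq_cvg do rewrite sE.
  apply: cvgM; last first.
    have := dc k; rewrite /derivable /derive => /= cvgd.
    have e : (fun h => h^-1 * d k h) =
       (fun h => h^-1 *: (c (h *: v + x) 0 k - c x 0 k)).
      by apply/funext => h; rewrite /d C0.
    by rewrite e.
  apply/cvgrPdist_lt => e e0.
  have := z_near _ dF; move: (cF k) => /cvgrPdist_lt /(_ _ e0) /z_near H1 H2.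
  apply: filterS2 H1 H2 => h h1 h2.
  rewrite /s; case: eqP => [_|/eqP dh0]; first by rewrite subrr normr0.
  rewrite zS; have [|u ud ->] := @MVT_line _ F (z k h) (delta_mx 0 k) (d k h).
    by move=> u ud; exact: h2.
  by rewrite mulrAC mulfV// mul1r; exact: h1.
have lim : h^-1 *: (((F \o c) \o shift x) (h *: v) - (F \o c) x) @[h --> 0^'] -->
    \sum_k pderiv k F (c x) * 'D_v (fun w => c w 0 k) x.
  have e : (fun h => h^-1 *: (((F \o c) \o shift x) (h *: v) - (F \o c) x)) =
      (fun h => \sum_(k < n) h^-1 * (F (z k.+1 h) - F (z k h))).
    apply/funext => h; rewrite -mulr_sumr; congr (_ * _).
    rewrite -(big_mkord xpredT (fun k => F (z k.+1 h) - F (z k h))) telescope_sumr//.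
    congr (F _ - F _).
      by apply/rowP => j; rewrite mxE ltn_ord.
    by apply/rowP => j; rewrite mxE ltn0 C0.
  by rewrite e; apply: cvg_big => [|k _]; [exact: add_continuous | exact: step].
apply: DeriveDef; first by apply/cvg_ex; eexists; exact: lim.
exact/cvg_lim.
Qed.


Lemma is_derive_shift_arg (V : normedModType R) (f : V -> R) (z w v : V) :
  derivable f (z + w) v -> is_derive z v (fun z => f (z + w)) ('D_v f (z + w)).
Proof.
move=> df.
have e : (fun h => h^-1 *: (((fun z => f (z + w)) \o shift z) (h *: v) - f (z + w)))
   = (fun h => h^-1 *: ((f \o shift (z + w)) (h *: v) - f (z + w))).
  by apply/funext => h /=; rewrite addrA.
by apply: DeriveDef; rewrite /derivable /derive /= e.
Qed.

(** * Symmetry of second partial derivatives *)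

Section Schwarz.
Variable n : nat.
Implicit Types (f : 'rV[R]_n -> R) (y : 'rV[R]_n) (k l : 'I_n).
Local Notation "''e_' k" := (delta_mx 0 k : 'rV[R]_n) (at level 8, k at level 2).

(** Two applications of the mean value theorem, first along $e_k$ to the increment $f(z + t e_l) -
    f(z)$, then along $e_l$ to $\partial_k f$, turn the quotient into $\partial_l\partial_k f$ at a
    point tending to [y]. *)
Lemma second_difference_cvg f y k l :
  (\forall z \near y, derivable f z 'e_k /\ derivable (pderiv k f) z 'e_l) ->
  {for y, continuous (pderiv l (pderiv k f))} ->
  (t * t)^-1 * (f (y + t *: 'e_k + t *: 'e_l) - f (y + t *: 'e_k)
     - f (y + t *: 'e_l) + f y) @[t --> 0^'] --> pderiv l (pderiv k f) y.
Proof.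
move=> df cf; apply/cvgrPdist_lt => e e0.
have Pnear (P : set 'rV[R]_n) : (\forall w \near y, P w) -> \forall t \near (0 : R)^',
    forall u w : R, `|u| <= `|t| -> `|w| <= `|t| -> P (y + u *: 'e_k + w *: 'e_l).
  move=> /nbhs_ballP[d /= d0 dP]; have d20 : 0 < d / 2 by rewrite divr_gt0.
  have H : \forall t \near (0 : R)^', `|t| < d / 2 by exact: dnbhs0_lt.
  apply: filterS H => t td u w ut wt.
  apply: dP; split => // i j; rewrite ord1 !mxE /ball /= distrC.
  rewrite -addrA addrAC subrr add0r (le_lt_trans (ler_normD _ _))// !normrM (splitr d).
  rewrite ltr_leD//.
    rewrite (le_lt_trans _ (le_lt_trans ut td))// ler_piMr//.
    by rewrite normr_nat lern1 leq_b1.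
  rewrite (le_trans _ (le_trans wt (ltW td)))// ler_piMr//.
  by rewrite normr_nat lern1 leq_b1.
have := Pnear _ df; move/cvgrPdist_lt: cf => /(_ _ e0)/Pnear H1 H2.
have H3 := @nbhs_dnbhs_neq R 0.
apply: filterS3 H1 H2 H3 => t h1 h2 t0.
pose F z := f (z + t *: 'e_l) - f z.
have dF (u : R) : `|u| <= `|t| -> is_derive (y + u *: 'e_k) 'e_k F
    (pderiv k f (y + u *: 'e_k + t *: 'e_l) - pderiv k f (y + u *: 'e_k)).
  move=> ut; apply: is_deriveB.
    by apply: is_derive_shift_arg; have [] := h2 u t ut (lexx _).
  apply: derivableP; have := h2 u 0 ut; rewrite normr0 scale0r addr0.
  by case/(_ (normr_ge0 _)).
have [|u ut eF] := @MVT_line _ F y 'e_k t.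
  by move=> u /dF[].
have [|w wt ew] := @MVT_line _ (pderiv k f) (y + u *: 'e_k) 'e_l t.
  by move=> w wt; have [] := h2 u w ut wt.
have [_ dFu] := dF u ut.
have -> : f (y + t *: 'e_k + t *: 'e_l) - f (y + t *: 'e_k) - f (y + t *: 'e_l) + f y
   = F (y + t *: 'e_k) - F y.
  by rewrite /F; ring.
rewrite eF dFu ew mulrA mulKf ?mulf_neq0//; exact: h1.
Qed.

(** The second difference is symmetric in k and l, so both mixed derivatives are limits of the same
    quotient. *)
Lemma pderivC (U : set 'rV[R]_n) f y k l : open U -> smooth_on U f -> U y ->
  pderiv k (pderiv l f) y = pderiv l (pderiv k f) y.
Proof.
move=> oU sf Uy.
pose D k' l' (t : R) := (t * t)^-1 * (f (y + t *: 'e_k' + t *: 'e_l') - f (y + t *: 'e_k')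
     - f (y + t *: 'e_l') + f y).
have cvgD k' l' : D k' l' t @[t --> 0^'] --> pderiv l' (pderiv k' f) y.
  apply: second_difference_cvg; last by have [] := sf [:: l'; k'] y Uy.
  have : nbhs y U by exact: open_nbhs_nbhs.
  apply: filterS => z Uz; split; first by have [_] := sf [::] z Uz; apply.
  by have [_] := sf [:: k'] z Uz; apply.
have DC : D l k = D k l.
  apply/funext => t; rewrite /D [y + _ + _]addrAC; ring.
have H := cvgD l k; rewrite DC in H.
exact: cvg_unique H (cvgD k l).
Qed.

End Schwarz.

(** * Smooth functions on an open set *)

Section SmoothOn.
Variables (n : nat) (U : set 'rV[R]_n).
Hypothesis oU : open U.
Implicit Types f : 'rV[R]_n -> R.

Lemma smooth_on_derivable f y k :
  smooth_on U f -> U y -> derivable f y (delta_mx 0 k).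
Proof. by move=> sf Uy; have [_] := sf [::] y Uy; apply. Qed.

Lemma smooth_on_pderiv f k : smooth_on U f -> smooth_on U (pderiv k f).
Proof. by move=> sf s; have := sf (rcons s k); rewrite foldr_rcons. Qed.

Lemma near_open y f1 f2 : {in U, f1 =1 f2} -> U y -> \near y, f1 y = f2 y.
Proof.
move=> f12 Uy; have : nbhs y U by exact: open_nbhs_nbhs.
by apply: filterS => z Uz; apply: f12; rewrite inE.
Qed.

Lemma eq_pderiv f1 f2 k : {in U, f1 =1 f2} -> {in U, pderiv k f1 =1 pderiv k f2}.
Proof. by move=> f12 y; rewrite inE => Uy; apply/near_eq_derive/near_open. Qed.

Lemma eq_smooth_on f1 f2 : {in U, f1 =1 f2} -> smooth_on U f1 -> smooth_on U f2.
Proof.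
move=> f12 sf s.
have {}f12 : {in U, foldr (@pderiv R n) f1 s =1 foldr (@pderiv R n) f2 s}.
  by elim: s => //= k s; exact: eq_pderiv.
move=> h y Uy; have [c d] := sf s y Uy.
have nearE := near_open f12 Uy; split; last first.
  by move=> k; apply: near_eq_derivable (d k).
suff : h z @[z --> y] --> foldr (@pderiv R n) f1 s y by rewrite (nbhs_singleton nearE).
exact: (cvg_trans (near_eq_cvg nearE) c).
Qed.

Lemma smooth_on0 : smooth_on U (fun=> 0).
Proof.
move=> s; have -> : foldr (@pderiv R n) (fun=> 0) s = fun=> 0.
  by elim: s => //= k s ->; apply/funext => y; rewrite /pderiv derive_cst.
by move=> h y _; split=> [|k]; [exact: cst_continuous | exact: derivable_cst].
Qed.

(** Linear combinations are enough: the components of an exterior derivative are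
    constant-coefficient combinations of partial derivatives. *)
Lemma smooth_on_lin (a : R) f1 f2 : smooth_on U f1 -> smooth_on U f2 ->
  smooth_on U (fun y => a * f1 y + f2 y).
Proof.
move=> s1 s2 s.
have e : {in U, foldr (@pderiv R n) (fun y => a * f1 y + f2 y) s =1
   (a *: foldr (@pderiv R n) f1 s) + foldr (@pderiv R n) f2 s}.
  elim: s => //= k s IH y Uy; rewrite (eq_pderiv k IH)// /pderiv.
  move: Uy; rewrite inE => /[dup] /(s1 s)[_ d1] /(s2 s)[_ d2].
  by rewrite deriveD ?deriveZ//; exact: derivableZ.
move=> h y Uy; have nearE := near_open e Uy.
have [c1 d1] := s1 s y Uy; have [c2 d2] := s2 s y Uy; split.
  suff : h z @[z --> y] --> (a *: foldr (@pderiv R n) f1 s + foldr (@pderiv R n) f2 s) y.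
    by rewrite -(nbhs_singleton nearE).
  have : (a *: foldr (@pderiv R n) f1 s + foldr (@pderiv R n) f2 s) z @[z --> y] -->
     (a *: foldr (@pderiv R n) f1 s + foldr (@pderiv R n) f2 s) y.
    by apply: cvgD c2; exact: cvgZr.
  have nearE' : \near y, (a *: foldr (@pderiv R n) f1 s + foldr (@pderiv R n) f2 s) y = h y.
    by move: nearE; apply: filterS => z Ez; rewrite /h Ez.
  exact: (cvg_trans (near_eq_cvg nearE')).
move=> k; apply: near_eq_derivable (derivableD (derivableZ (k := a) (d1 k)) (d2 k)).
by move: nearE; apply: filterS => z Ez; rewrite /h Ez.
Qed.

Lemma smooth_on_sum (I : finType) (P : pred I) (a : I -> R) (F : I -> 'rV[R]_n -> R) :
  (forall i, smooth_on U (F i)) -> smooth_on U (fun y => \sum_(i | P i) a i * F i y).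
Proof.
move=> sF; rewrite (_ : (fun y => _) = \sum_(i | P i) (fun y => a i * F i y)); last first.
  by apply/funext => y; rewrite fct_sumE.
elim/big_ind : _ => [|f1 f2 s1 s2|i _]; first exact: smooth_on0.
  by apply: eq_smooth_on (smooth_on_lin 1 s1 s2) => y _; rewrite mul1r.
by apply: eq_smooth_on (smooth_on_lin (a i) (sF i) smooth_on0) => y _; rewrite addr0.
Qed.

End SmoothOn.

End PartialDerivatives.

(** * Derivatives of finite sums and products *)

Section DeriveBig.
Variables (R : realType) (V : normedModType R).
Implicit Types (x v : V).

Lemma is_derive_big_sum (I : finType) (P : pred I) (F : I -> V -> R) x v :
  (forall j, derivable (F j) x v) ->
  is_derive x v (fun z => \sum_(j | P j) F j z) (\sum_(j | P j) 'D_v (F j) x).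
Proof.
move=> dF; rewrite (_ : (fun z => _) = \sum_(j | P j) F j); last first.
  by apply/funext => z; rewrite fct_sumE.
elim/big_rec2 : _ => [|j y f _ df]; first exact: is_derive_cst.
by apply: is_deriveD => //; exact: derivableP.
Qed.

Lemma is_derive_prod q (f : 'I_q -> V -> R) x v :
  (forall r, derivable (f r) x v) ->
  is_derive x v (fun z => \prod_(r < q) f r z)
    (\sum_(r < q) 'D_v (f r) x * \prod_(s < q | s != r) f s x).
Proof.
elim: q f => [|q IH] f df.
  rewrite big_ord0 (_ : (fun z => _) = cst 1); first exact: is_derive_cst.
  by apply/funext => z; rewrite big_ord0.
rewrite (_ : (fun z => _) = f ord0 * (fun z => \prod_(r < q) f (lift ord0 r) z)); last first.
  by apply/funext => z; rewrite big_ord_recl.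
have d0 := derivableP (df ord0); have dS := IH _ (fun r => df (lift ord0 r)).
apply: is_derive_eq (is_deriveM d0 dS) _.
rewrite big_ord_recl addrC; congr (_ + _).
  rewrite mulrC; congr (_ * _).
  by rewrite [RHS]big_mkcond big_ord_recl /= mul1r.
rewrite /GRing.scale /= mulr_sumr; apply: eq_bigr => r _; rewrite mulrCA; congr (_ * _).
by rewrite [RHS]big_mkcond big_ord_recl /= [in LHS]big_mkcond; congr (_ * _).
Qed.

End DeriveBig.

(** * Covariant derivatives in a chart *)

Section ChartCalculus.
Variables (R : realType) (n : nat) (M : smooth_manifold R n) (i : chart_index M).
Implicit Types (f : M -> R) (x : M) (k l : 'I_n).

(** First-order regularity is all that is asked of products, of the inverse metric and of the
    Christoffel symbols; full smoothness is kept for the given tensors and their partial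
    derivatives. *)
Definition derivable_in_chart f : Prop :=
  forall x, chart_dom i x -> forall k,
    derivable (f \o chart_inv i) (chart i x) (delta_mx 0 k).

Lemma chart_img x : chart_dom i x -> (chart i @` chart_dom i) (chart i x).
Proof. by move=> xi; exists x. Qed.

Lemma smooth_derivable_in_chart f : smooth_in_chart i f -> derivable_in_chart f.
Proof. by move=> sf x xi k; apply: smooth_on_derivable sf (chart_img xi). Qed.

Lemma smooth_dcoord f k : smooth_in_chart i f -> smooth_in_chart i (dcoord i k f).
Proof.
move=> sf; apply: eq_smooth_on (smooth_on_pderiv k sf); first exact: chart_img_open.
by move=> y; rewrite inE => -[x xi <-]; rewrite /= /dcoord chartK.
Qed.

Lemma dcoordC f k l x : smooth_in_chart i f -> chart_dom i x ->
  dcoord i k (dcoord i l f) x = dcoord i l (dcoord i k f) x.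
Proof.
move=> sf xi; rewrite /dcoord.
have e k' : {in chart i @` chart_dom i, dcoord i k' f \o chart_inv i =1
    pderiv k' (f \o chart_inv i)}.
  by move=> y; rewrite inE => -[z zi <-]; rewrite /= /dcoord chartK.
have oi := @chart_img_open _ _ _ i; have xI : chart i x \in chart i @` chart_dom i.
  by rewrite inE; exact: chart_img.
rewrite (eq_pderiv oi k (e l) xI) (eq_pderiv oi l (e k) xI).
exact: (pderivC _ _ oi sf (chart_img xi)).
Qed.

Lemma eq_derivable_in_chart f1 f2 : (forall x, chart_dom i x -> f1 x = f2 x) ->
  derivable_in_chart f1 -> derivable_in_chart f2.
Proof.
move=> f12 d1 x xi k; apply: near_eq_derivable (d1 x xi k).
apply: (near_open (@chart_img_open _ _ _ i)) (chart_img xi) => y.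
by rewrite inE => -[z zi <-]; rewrite /= chartK// f12.
Qed.

Lemma derivable_in_chart_cst c : derivable_in_chart (fun=> c).
Proof. by move=> x xi k; exact: derivable_cst. Qed.

Lemma derivable_in_chartD f1 f2 : derivable_in_chart f1 -> derivable_in_chart f2 ->
  derivable_in_chart (fun x => f1 x + f2 x).
Proof. by move=> d1 d2 x xi k; exact: derivableD (d1 x xi k) (d2 x xi k). Qed.

Lemma derivable_in_chartN f : derivable_in_chart f ->
  derivable_in_chart (fun x => - f x).
Proof. by move=> d1 x xi k; exact: derivableN (d1 x xi k). Qed.

Lemma derivable_in_chartB f1 f2 : derivable_in_chart f1 -> derivable_in_chart f2 ->
  derivable_in_chart (fun x => f1 x - f2 x).
Proof. by move=> d1 d2; exact/derivable_in_chartD/derivable_in_chartN. Qed.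

Lemma derivable_in_chartM f1 f2 : derivable_in_chart f1 -> derivable_in_chart f2 ->
  derivable_in_chart (fun x => f1 x * f2 x).
Proof. by move=> d1 d2 x xi k; exact: derivableM (d1 x xi k) (d2 x xi k). Qed.

Lemma derivable_in_chartZ c f : derivable_in_chart f ->
  derivable_in_chart (fun x => c * f x).
Proof. exact/derivable_in_chartM/derivable_in_chart_cst. Qed.

Lemma derivable_in_chartV f : derivable_in_chart f ->
  (forall x, chart_dom i x -> f x != 0) -> derivable_in_chart (fun x => (f x)^-1).
Proof.
move=> d1 f0 x xi k; apply: derivableV (d1 x xi k) => //=.
by rewrite chartK// f0.
Qed.

Lemma derivable_in_chart_sum (I : finType) (P : pred I) (F : I -> M -> R) :
  (forall j, derivable_in_chart (F j)) ->
  derivable_in_chart (fun x => \sum_(j | P j) F j x).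
Proof.
move=> dF x xi k.
by have [] := is_derive_big_sum P (fun j => dF j x xi k).
Qed.

Lemma derivable_in_chart_prod q (F : 'I_q -> M -> R) :
  (forall j, derivable_in_chart (F j)) ->
  derivable_in_chart (fun x => \prod_j F j x).
Proof.
move=> dF x xi k.
by have [] := is_derive_prod (fun j => dF j x xi k).
Qed.

Lemma derivable_in_chart_det m (A : M -> 'M[R]_m) :
  (forall a b, derivable_in_chart (fun x => A x a b)) ->
  derivable_in_chart (fun x => \det (A x)).
Proof.
move=> dA; apply: derivable_in_chart_sum => s; apply: derivable_in_chartZ.
by apply: derivable_in_chart_prod => j.
Qed.

Lemma dcoord_cst k c x : dcoord i k (fun=> c) x = 0.
Proof. exact: derive_cst. Qed.

Lemma dcoordD k f1 f2 x : chart_dom i x -> derivable_in_chart f1 -> derivable_in_chart f2 ->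
  dcoord i k (fun x => f1 x + f2 x) x = dcoord i k f1 x + dcoord i k f2 x.
Proof. by move=> xi d1 d2; exact: deriveD (d1 x xi k) (d2 x xi k). Qed.

Lemma dcoordN k f x : chart_dom i x -> derivable_in_chart f ->
  dcoord i k (fun x => - f x) x = - dcoord i k f x.
Proof. by move=> xi d1; exact: deriveN (d1 x xi k). Qed.

Lemma dcoordB k f1 f2 x : chart_dom i x -> derivable_in_chart f1 -> derivable_in_chart f2 ->
  dcoord i k (fun x => f1 x - f2 x) x = dcoord i k f1 x - dcoord i k f2 x.
Proof. by move=> xi d1 d2; rewrite dcoordD ?dcoordN//; exact: derivable_in_chartN. Qed.

Lemma dcoordM k f1 f2 x : chart_dom i x -> derivable_in_chart f1 -> derivable_in_chart f2 ->
  dcoord i k (fun x => f1 x * f2 x) x = dcoord i k f1 x * f2 x + f1 x * dcoord i k f2 x.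
Proof.
move=> xi d1 d2; rewrite /dcoord /pderiv [LHS](deriveM (d1 x xi k) (d2 x xi k)) /=.
by rewrite chartK// addrC [_ * f2 x]mulrC.
Qed.

Lemma dcoordZ k c f x : chart_dom i x -> derivable_in_chart f ->
  dcoord i k (fun x => c * f x) x = c * dcoord i k f x.
Proof.
move=> xi d1; rewrite dcoordM ?dcoord_cst ?mul0r ?add0r//.
exact: derivable_in_chart_cst.
Qed.

Lemma dcoord_sum (I : finType) (P : pred I) k (F : I -> M -> R) x :
  chart_dom i x -> (forall j, derivable_in_chart (F j)) ->
  dcoord i k (fun x => \sum_(j | P j) F j x) x = \sum_(j | P j) dcoord i k (F j) x.
Proof.
move=> xi dF.
by have [] := is_derive_big_sum P (fun j => dF j x xi k).
Qed.

End ChartCalculus.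

Section LeviCivita.
Variables (R : realType) (n : nat) (M : smooth_manifold R n) (g : metric_tensor M).
Variable i : chart_index M.
Local Notation idx p := {ffun 'I_p -> 'I_n}.
Local Notation Gam := (christoffel g i).
Local Notation regular := (@derivable_in_chart R n M i).

Definition metric_mx x : 'M[R]_n := \matrix_(a, b) gdown g i a b x.

Lemma metric_mx_unit x : chart_dom i x -> metric_mx x \in unitmx.
Proof. exact: metric_ctensor_nondegenerate. Qed.

Lemma gdown_sym x a b : chart_dom i x -> gdown g i a b x = gdown g i b a x.
Proof. by move=> xi; exact: metric_ctensor_sym. Qed.

Lemma gup_gdown x a b : chart_dom i x ->
  \sum_c gup g i a c x * gdown g i c b x = (a == b)%:R.
Proof.
move=> xi; have /matrixP/(_ a b) := mulVmx (metric_mx_unit xi).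
by rewrite !mxE => <-; apply: eq_bigr => c _; rewrite !mxE.
Qed.

Lemma gup_sym x a b : chart_dom i x -> gup g i a b x = gup g i b a x.
Proof.
move=> xi; rewrite /gup -/(metric_mx x).
have eT : (metric_mx x)^T = metric_mx x.
  by apply/matrixP => c d; rewrite !mxE gdown_sym.
by rewrite -[in LHS]eT -trmx_inv mxE.
Qed.

Lemma gdown_smooth a b : smooth_in_chart i (gdown g i a b).
Proof. exact: ctensor_smooth. Qed.

Lemma gdown_regular a b : regular (gdown g i a b).
Proof. exact/smooth_derivable_in_chart/gdown_smooth. Qed.

(** By Cramer's rule the entries of the inverse are polynomials in those of the metric, divided by a
    determinant that does not vanish in the chart. *)
Lemma gup_regular a b : regular (gup g i a b).
Proof.
have dG c d : regular (fun x => metric_mx x c d).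
  rewrite (_ : (fun x => _) = gdown g i c d); first exact: gdown_regular.
  by apply/funext => x; rewrite mxE.
apply: (@eq_derivable_in_chart _ _ _ _
    (fun x => (\det (metric_mx x))^-1 * \adj (metric_mx x) a b)) => [x xi|].
  by rewrite /gup -/(metric_mx x) /invmx metric_mx_unit// [RHS]mxE.
apply: derivable_in_chartM.
  apply: derivable_in_chartV; first exact: derivable_in_chart_det.
  by move=> x xi; have := metric_mx_unit xi; rewrite unitmxE unitfE.
rewrite (_ : (fun x => _) = (fun x => cofactor (metric_mx x) b a)); last first.
  by apply/funext => x; rewrite mxE.
apply: derivable_in_chartZ; apply: derivable_in_chart_det => c d.
rewrite (_ : (fun x => _) = (fun x => metric_mx x (lift b c) (lift a d))) //.
by apply/funext => x; rewrite !mxE.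
Qed.

Lemma christoffel_regular c a b : regular (christoffel g i c a b).
Proof.
apply/derivable_in_chartZ/derivable_in_chart_sum => d.
apply: derivable_in_chartM; first exact: gup_regular.
have dd e k l : regular (dcoord i k (gdown g i e l)).
  exact/smooth_derivable_in_chart/smooth_dcoord/gdown_smooth.
by apply: derivable_in_chartB; first exact: derivable_in_chartD.
Qed.

Lemma riemann_up_curvature lam x a b c d : curvature_constant g lam -> chart_dom i x ->
  riemann_up g i a b c d x =
    lam * ((a == c)%:R * gdown g i b d x - (a == d)%:R * gdown g i b c x).
Proof.
move=> curv xi.
have -> : riemann_up g i a b c d x = \sum_e gup g i a e x * riemann g i e b c d x.
  rewrite /riemann; under eq_bigr do rewrite mulr_sumr.
  rewrite exchange_big (bigD1 a)//= [X in _ + X]big1 ?addr0 => [|f /negPf fa].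
    by under eq_bigr do rewrite mulrA; rewrite -mulr_suml gup_gdown// eqxx mul1r.
  by under eq_bigr do rewrite mulrA; rewrite -mulr_suml gup_gdown// eq_sym fa mul0r.
under eq_bigr => e _ do rewrite (curv i x xi) mulrCA mulrBr !mulrA.
rewrite -mulr_sumr; congr (_ * _).
by rewrite sumrB -!mulr_suml !gup_gdown.
Qed.


Lemma nablaE p (T : components M p) k b x :
  nabla g T i (icons k b) x = dcoord i k (T i b) x
    - \sum_r \sum_c Gam c k (b r) x * T i (isubst b r c) x.
Proof. by rewrite /nabla icons0 itail_icons. Qed.

Lemma nabla_regular p (T : components M p) b :
  (forall b, smooth_in_chart i (T i b)) -> regular (nabla g T i b).
Proof.
move=> sT; apply: derivable_in_chartB.
  exact/smooth_derivable_in_chart/smooth_dcoord.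
apply: derivable_in_chart_sum => r; apply: derivable_in_chart_sum => c.
apply: derivable_in_chartM; first exact: christoffel_regular.
exact/smooth_derivable_in_chart.
Qed.

Lemma eq_nabla p (T1 T2 : components M p) x b : chart_dom i x ->
  (forall z, chart_dom i z -> forall b, T1 i b z = T2 i b z) ->
  nabla g T1 i b x = nabla g T2 i b x.
Proof.
move=> xi T12; rewrite /nabla; congr (_ - _).
  by apply: eq_dcoord => // z zi; rewrite T12.
by apply: eq_bigr => r _; apply: eq_bigr => c _; rewrite T12.
Qed.

Lemma nablaD p (T1 T2 : components M p) x b : chart_dom i x ->
  (forall b, regular (T1 i b)) -> (forall b, regular (T2 i b)) ->
  nabla g (fun i b x => T1 i b x + T2 i b x) i b x = nabla g T1 i b x + nabla g T2 i b x.
Proof.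
move=> xi d1 d2; rewrite /nabla dcoordD// addrACA -opprD; congr (_ - _).
rewrite -big_split; apply: eq_bigr => r _ /=; rewrite -big_split; apply: eq_bigr => c _ /=.
by rewrite mulrDr.
Qed.

Lemma nablaZ p (T : components M p) (c : R) x b : chart_dom i x ->
  (forall b, regular (T i b)) ->
  nabla g (fun i b x => c * T i b x) i b x = c * nabla g T i b x.
Proof.
move=> xi d1; rewrite /nabla dcoordZ// mulrBr mulr_sumr; congr (_ - _).
apply: eq_bigr => r _; rewrite mulr_sumr; apply: eq_bigr => e _.
by rewrite mulrCA.
Qed.

Lemma nablaB p (T1 T2 : components M p) x b : chart_dom i x ->
  (forall b, regular (T1 i b)) -> (forall b, regular (T2 i b)) ->
  nabla g (fun i b x => T1 i b x - T2 i b x) i b x = nabla g T1 i b x - nabla g T2 i b x.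
Proof.
move=> xi d1 d2; rewrite -mulN1r -nablaZ// -nablaD//; last first.
  by move=> c; exact: derivable_in_chartZ.
by apply: eq_nabla => // z zi c; rewrite mulN1r.
Qed.

Lemma nabla_sum p (I : finType) (T : I -> components M p) x b : chart_dom i x ->
  (forall j b, regular (T j i b)) ->
  nabla g (fun i b x => \sum_j T j i b x) i b x = \sum_j nabla g (T j) i b x.
Proof.
move=> xi dT; rewrite /nabla dcoord_sum// sumrB; congr (_ - _).
rewrite [RHS]exchange_big; apply: eq_bigr => r _ /=; rewrite [RHS]exchange_big.
by apply: eq_bigr => c _; rewrite mulr_sumr.
Qed.

(** The connection acts on every slot in the same way, so permuting slots commutes with it. *)
Lemma nabla_iperm p (T : components M p) (s : 'S_p) k b x :
  nabla g (fun i b x => T i (iperm b s) x) i (icons k b) x =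
  nabla g T i (icons k (iperm b s)) x.
Proof.
rewrite !nablaE; congr (_ - _).
rewrite (reindex_inj (@perm_inj _ s)); apply: eq_bigr => r _; apply: eq_bigr => c _.
by rewrite iperm_isubst ffunE.
Qed.

Lemma nabla_skewsym p (T : components M p) k x : chart_dom i x ->
  (forall b, regular (T i b)) ->
  (forall z, chart_dom i z -> skewsym (fun b => T i b z)) ->
  skewsym (fun b => nabla g T i (icons k b) x).
Proof.
move=> xi dT skT b s; rewrite -nabla_iperm -nablaZ//.
by apply: eq_nabla => // z zi c; exact: skT.
Qed.

Lemma nabla_metric_mul q (h : components M q) k b x : chart_dom i x ->
  (forall b, regular (h i b)) ->
  nabla g (fun i (c : idx q.+2) x => gdown g i (c ord0) (c (lift ord0 ord0)) x
      * h i (itail (itail c)) x) i (icons k b) x =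
  gdown g i (b ord0) (b (lift ord0 ord0)) x * nabla g h i (icons k (itail (itail b))) x.
Proof.
move=> xi dh; rewrite !nablaE dcoordM//; last exact: gdown_regular.
(* Metricity trades the derivative of the metric for two Christoffel sums, which cancel the
   contributions of the first two slots of the product. *)
have := nabla_metric g (icons k (index2 (b ord0) (b (lift ord0 ord0)))) xi.
rewrite nablaE !big_ord_recl big_ord0 addr0 => /eqP; rewrite subr_eq0 => /eqP eg.
rewrite /gdown in eg *; rewrite eg mulrBr mulrDl.
set S0 := \sum_c Gam c k (index2 _ _ ord0) x * _.
set S1 := \sum_c Gam c k (index2 _ _ (lift ord0 ord0)) x * _.
set P0 := \sum_c Gam c k (b ord0) x * _.
set P1 := \sum_c Gam c k (b (lift ord0 ord0)) x * _.
have -> : P0 = S0 * h i (itail (itail b)) x.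
  rewrite mulr_suml; apply: eq_bigr => c _.
  by rewrite /index2 icons0 isubst_icons0 isubst_same isubst_neq// itail_isubst0 mulrA.
have -> : P1 = S1 * h i (itail (itail b)) x.
  rewrite mulr_suml; apply: eq_bigr => c _.
  rewrite /index2 iconsS isubst_iconsS isubst_same isubst_neq// itail_isubstS itail_isubst0.
  rewrite ffunE mulrA; congr (_ * g i (icons _ _) _ * _).
  by apply/ffunP => l; rewrite !ffunE (ord1 l) eqxx.
set P := \sum_(r < q) _; set Q := \sum_(r < q) _.
have -> : P = g i (index2 (b ord0) (b (lift ord0 ord0))) x * Q.
  rewrite mulr_sumr; apply: eq_bigr => r _; rewrite mulr_sumr; apply: eq_bigr => c _.
  rewrite !isubst_neq ?(inj_eq lift_inj) ?neq_lift// !itail_isubstS.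
  by rewrite mulrCA !ffunE.
ring.
Qed.

End LeviCivita.

Section RicciIdentity.
Variables (R : realType) (n : nat) (M : smooth_manifold R n) (g : metric_tensor M).
Variable i : chart_index M.
Local Notation idx p := {ffun 'I_p -> 'I_n}.
Local Notation Gam := (christoffel g i).
Local Notation regular := (@derivable_in_chart R n M i).
Local Notation G x := (fun a b => gdown g i a b x).

(** The wedge is $g\otimes h$ minus copies of it with two slots exchanged by [t r]; the covariant
    derivative commutes with these exchanges and passes through the metric. *)
Lemma nabla_wedge q (h : components M q) k a b1 (b : idx q) x : chart_dom i x ->
  (forall b, regular (h i b)) ->
  nabla g (fun i (c : idx q.+2) x => wedge (fun a b => gdown g i a b x) (fun b => h i b x)
      (c ord0) (c (lift ord0 ord0)) (itail (itail c))) i (icons k (icons a (icons b1 b))) x =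
  wedge (G x) (fun b => nabla g h i (icons k b) x) a b1 b.
Proof.
move=> xi dh.
pose P : components M q.+2 := fun i (c : idx q.+2) x =>
  gdown g i (c ord0) (c (lift ord0 ord0)) x * h i (itail (itail c)) x.
pose t r : 'S_q.+2 := tperm (lift ord0 ord0) (lift ord0 (lift ord0 r)).
have permE a' b1' (b' : idx q) r :
    iperm (icons a' (icons b1' b')) (t r) = icons a' (icons (b' r) (isubst b' r b1')).
  by rewrite /t -lift_tperm iperm_icons_lift iperm_icons_tperm0.
have PE a' b1' b' z : P i (icons a' (icons b1' b')) z = gdown g i a' b1' z * h i b' z.
  by rewrite /P icons0 iconsS icons0 !itail_icons.
have dP b' : regular (P i b').
  by apply: derivable_in_chartM => //; exact: gdown_regular.
rewrite (@eq_nabla _ _ _ _ _ _ _ (fun i c x => P i c x - \sum_r P i (iperm c (t r)) x))//.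
  rewrite nablaB//; last by move=> c; apply: derivable_in_chart_sum.
  rewrite nabla_sum//.
  under eq_bigr => r _ do rewrite nabla_iperm permE.
  rewrite nabla_metric_mul// icons0 iconsS icons0 !itail_icons; congr (_ - _).
  apply: eq_bigr => r _.
  by rewrite nabla_metric_mul// icons0 iconsS icons0 !itail_icons.
move=> z zi c; rewrite -[c]icons_itail -[itail c]icons_itail PE /wedge.
rewrite icons0 iconsS icons0 !itail_icons; congr (_ - _).
by apply: eq_bigr => r _; rewrite permE PE.
Qed.

Lemma ricci_identity p (T : components M p) k l b x : chart_dom i x ->
  (forall b, smooth_in_chart i (T i b)) ->
  nabla g (nabla g T) i (icons k (icons l b)) x -
  nabla g (nabla g T) i (icons l (icons k b)) x =
  - \sum_r \sum_e riemann_up g i e (b r) k l x * T i (isubst b r e) x.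
Proof.
move=> xi sT.
have dT b' : regular (T i b') by exact: smooth_derivable_in_chart.
have ddT k' b' : regular (dcoord i k' (T i b')).
  exact/smooth_derivable_in_chart/smooth_dcoord.
have dGT l' (r : 'I_p) c : regular (fun x => Gam c l' (b r) x * T i (isubst b r c) x).
  by apply: derivable_in_chartM; [exact: christoffel_regular | exact: dT].
(* Christoffel symbols act on two distinct slots in [quad], twice on one slot in [E], and on the
   inner differentiation index in [C]; the derivative hits the symbol in [A] and the tensor in [B].
   The terms [quad], [C], the sum of the two [B] and the second partials are symmetric in k, l. What
   remains, [A] and [E], antisymmetrizes to the Riemann tensor. *)
pose quad k l := \sum_r \sum_e \sum_(s | s != r) \sum_f
  Gam e k (b r) x * (Gam f l (b s) x * T i (isubst (isubst b r e) s f) x).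
pose A k l := \sum_r \sum_e dcoord i k (Gam e l (b r)) x * T i (isubst b r e) x.
pose B k l := \sum_r \sum_e Gam e l (b r) x * dcoord i k (T i (isubst b r e)) x.
pose C k l := \sum_e Gam e k l x * nabla g T i (icons e b) x.
pose E k l := \sum_r \sum_e (\sum_f Gam f k (b r) x * Gam e l f x) * T i (isubst b r e) x.
have expand k' l' : nabla g (nabla g T) i (icons k' (icons l' b)) x =
    dcoord i k' (dcoord i l' (T i b)) x - A k' l' - B k' l' - C k' l' - B l' k'
    + E k' l'
    + quad k' l'.
  rewrite nablaE big_ord_recl icons0.
  under [X in _ - (X + _)]eq_bigr => c _ do rewrite isubst_icons0.
  have -> : dcoord i k' (nabla g T i (icons l' b)) x = dcoord i k' (dcoord i l' (T i b)) x
    - A k' l' - B k' l'.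
    rewrite (@eq_dcoord _ _ _ _ _ _ (fun x => dcoord i l' (T i b) x
      - \sum_r \sum_c Gam c l' (b r) x * T i (isubst b r c) x))//; last first.
      by move=> z zi; rewrite nablaE.
    rewrite dcoordB//; last by do 2![apply: derivable_in_chart_sum => ?].
    rewrite -addrA -opprD /A /B; congr (_ - _); rewrite dcoord_sum//; last first.
      by move=> r; apply: derivable_in_chart_sum.
    rewrite -big_split; apply: eq_bigr => r _ /=; rewrite dcoord_sum// -big_split.
    by apply: eq_bigr => e _ /=; rewrite dcoordM//; exact: christoffel_regular.
  have -> : \sum_(r < p) \sum_c Gam c k' (icons l' b (lift ord0 r)) x *
        nabla g T i (isubst (icons l' b) (lift ord0 r) c) x =
    B l' k' - E k' l' - quad k' l'.
    rewrite /B /E /quad -!sumrB; apply: eq_bigr => r _; rewrite iconsS.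
    have -> : \sum_e (\sum_f Gam f k' (b r) x * Gam e l' f x) * T i (isubst b r e) x =
      \sum_e \sum_f Gam e k' (b r) x * (Gam f l' e x * T i (isubst b r f) x).
      rewrite exchange_big; apply: eq_bigr => e _; rewrite mulr_suml.
      by apply: eq_bigr => f _; rewrite mulrA.
    rewrite -!sumrB; apply: eq_bigr => e _.
    rewrite isubst_iconsS nablaE mulrBr (bigD1 r)//= mulrDr opprD addrA; congr (_ - _ - _).
      rewrite mulr_sumr; apply: eq_bigr => f _.
      by rewrite isubst_same isubst_isubst.
    rewrite mulr_sumr; apply: eq_bigr => s sr; rewrite mulr_sumr; apply: eq_bigr => f _.
    by rewrite isubst_neq.
  rewrite -/(C k' l').
  by move: (A k' l') (B k' l') (C k' l') (B l' k') (E k' l') (quad k' l') => *; ring.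
have quadC : quad k l = quad l k.
  have quadE k' l' : quad k' l' = \sum_r \sum_(s | s != r) \sum_e \sum_f
      Gam e k' (b r) x * (Gam f l' (b s) x * T i (isubst (isubst b r e) s f) x).
    by apply: eq_bigr => r _; rewrite exchange_big.
  rewrite !quadE (exchange_big_dep xpredT)//=; apply: eq_bigr => s _.
  apply: eq_big => [r|r rs]; first by rewrite eq_sym.
  rewrite exchange_big; apply: eq_bigr => f _; apply: eq_bigr => e _.
  by rewrite mulrCA isubstC// eq_sym.
have CC : C k l = C l k by apply: eq_bigr => e _; rewrite christoffel_sym.
rewrite !expand dcoordC// CC quadC.
have -> : \sum_r \sum_e riemann_up g i e (b r) k l x * T i (isubst b r e) x =
    A k l - A l k + E l k - E k l.
  have term r e : riemann_up g i e (b r) k l x = dcoord i k (Gam e l (b r)) x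
      - dcoord i l (Gam e k (b r)) x + \sum_f Gam f l (b r) x * Gam e k f x
      - \sum_f Gam f k (b r) x * Gam e l f x.
    rewrite /riemann_up -[RHS]addrA -sumrB; congr (_ + _); apply: eq_bigr => f _.
    by congr (_ - _); rewrite mulrC.
  under eq_bigr => r _ do [under eq_bigr => e _ do rewrite term mulrBl mulrDl mulrBl;
    rewrite sumrB big_split /= sumrB].
  by rewrite sumrB big_split /= sumrB.
move: (dcoord _ _ _ _) (A k l) (A l k) (B k l) (B l k) (C l k) (E k l) (E l k) (quad l k) => *.
ring.
Qed.

End RicciIdentity.

(** * The exterior derivative as a tensor *)

Section Pullback.
Variables (R : realType) (n : nat).
Local Notation idx p := {ffun 'I_p -> 'I_n}.

Lemma sum_icons q (F : idx q.+1 -> R) : \sum_b F b = \sum_a \sum_b F (icons a b).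
Proof.
rewrite pair_bigA (reindex (fun ab : 'I_n * idx q => icons ab.1 ab.2)) //=.
exists (fun b : idx q.+1 => (b ord0, itail b)) => [[a b] _|b _] /=; last exact: icons_itail.
by rewrite icons0 itail_icons.
Qed.

(** The same matrix [J] acts on every slot, so permuting the lower indices amounts to permuting the
    summation indices. *)
Lemma antisym_prod_sum p (J : 'I_n -> 'I_n -> R) (X : idx p -> R) (b : idx p) :
  antisym (fun b => \sum_(c : idx p) (\prod_k J (c k) (b k)) * X c) b =
  \sum_(c : idx p) (\prod_k J (c k) (b k)) * antisym X c.
Proof.
rewrite /antisym; under [RHS]eq_bigr do rewrite mulrCA; rewrite -mulr_sumr; congr (_ * _).
under [RHS]eq_bigr do rewrite mulr_sumr; rewrite [RHS]exchange_big /=.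
apply: eq_bigr => s _; rewrite mulr_sumr.
have iperm_inj : injective (fun c : idx p => iperm c s).
  move=> c d /ffunP cd; apply/ffunP => k.
  by have := cd (s^-1%g k); rewrite !ffunE permKV.
rewrite (reindex_inj iperm_inj); apply: eq_bigr => c _; rewrite mulrCA; congr (_ * _).
rewrite [RHS](reindex_inj (@perm_inj _ s)); apply: eq_bigr => k _.
by rewrite !ffunE.
Qed.

(* The second derivatives of the coordinate change drop out by symmetry. *)
Lemma antisym_pderiv_pullback q (U : set 'rV[R]_n) (phi : 'rV[R]_n -> 'rV[R]_n)
    (F H : idx q -> 'rV[R]_n -> R) y (b : idx q.+1) :
  open U -> U y -> (forall k, smooth_on U (fun z => phi z 0 k)) ->
  (forall z, U z -> forall c, F c z =
     \sum_(d : idx q) (\prod_r pderiv (c r) (fun z => phi z 0 (d r)) z) * H d (phi z)) ->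
  (forall c, \forall z \near phi y, forall k, derivable (H c) z (delta_mx 0 k)) ->
  (forall c k, {for phi y, continuous (pderiv k (H c))}) ->
  antisym (fun c => pderiv (c ord0) (F (itail c)) y) b =
  \sum_(c : idx q.+1) (\prod_k pderiv (b k) (fun z => phi z 0 (c k)) y) *
    antisym (fun d => pderiv (d ord0) (H (itail d)) (phi y)) c.
Proof.
move=> oU Uy sphi FE dH cH.
pose J k l := pderiv l (fun z => phi z 0 k).
have dphi k l : derivable (fun z => phi z 0 k) y (delta_mx 0 l).
  exact: smooth_on_derivable (sphi k) Uy.
have dJ k l a : derivable (J k l) y (delta_mx 0 a).
  exact: smooth_on_derivable (smooth_on_pderiv l (sphi k)) Uy.
have dHphi d a := is_derive_comp_partial (dH d) (cH d) (fun k => dphi k a).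
(* [Z] collects the terms in which the derivative falls on a Jacobian factor. *)
pose Z (d : idx q) (c : idx q.+1) := \sum_r pderiv (c ord0) (J (d r) (c (lift ord0 r))) y *
  \prod_(s | s != r) J (d s) (c (lift ord0 s)) y.
have dF (c : idx q.+1) : pderiv (c ord0) (F (itail c)) y =
    \sum_(d : idx q) Z d c * H d (phi y) +
    \sum_(d : idx q.+1) (\prod_k J (d k) (c k) y) * pderiv (d ord0) (H (itail d)) (phi y).
  have -> : pderiv (c ord0) (F (itail c)) y = 'D_(delta_mx 0 (c ord0))
      (fun z => \sum_(d : idx q) (fun z => \prod_r J (d r) (itail c r) z) z * (H d \o phi) z) y.
    apply: near_eq_derive; have : nbhs y U by exact: open_nbhs_nbhs.
    by apply: filterS => z Uz; rewrite FE.
  have dP (d : idx q) := is_derive_prod (fun r => dJ (d r) (itail c r) (c ord0)).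
  have dT d := is_deriveM (dP d) (dHphi d (c ord0)).
  have [_ ->] := is_derive_big_sum xpredT (fun d => @ex_derive _ _ _ _ _ _ _ (dT d)).
  under eq_bigr => d _ do rewrite (@derive_val _ _ _ _ _ _ _ (dT d)).
  rewrite big_split [LHS]addrC /=; congr (_ + _).
    apply: eq_bigr => d _; rewrite /GRing.scale /= mulrC; congr (_ * _).
    apply: eq_bigr => r _; rewrite ffunE; congr (_ * _).
    by apply: eq_bigr => s _; rewrite ffunE.
  rewrite sum_icons exchange_big; apply: eq_bigr => d _.
  rewrite /GRing.scale /= mulr_sumr; apply: eq_bigr => a _.
  rewrite big_ord_recl icons0 itail_icons mulrA mulrAC [_ * J _ _ y]mulrC; congr (_ * _ * _).
  by apply: eq_bigr => r _; rewrite iconsS ffunE.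
have E := antisym_prod_sum (fun k l => J k l y)
  (fun d : idx q.+1 => pderiv (d ord0) (H (itail d)) (phi y)) b.
rewrite (eq_antisym _ dF) antisymD [X in _ + X]E antisym_sum big1 ?add0r//.
move=> d _; rewrite (@eq_antisym _ _ _ _ (fun c => H d (phi y) * Z d c)); last first.
  by move=> c; rewrite mulrC.
rewrite antisymZ antisym_sum big1 ?mulr0// => r _.
(* The differentiation index and the lower index of the r-th Jacobian factor sit on one second
   partial derivative, symmetric in them. *)
apply: (@antisym_eq0 _ _ _ _ _ ord0 (lift ord0 r)); first exact: neq_lift.
move=> c; rewrite -[c]icons_itail iperm_icons_tperm0 !icons0 !iconsS isubst_same.
have JC k a l : pderiv a (J k l) y = pderiv l (J k a) y := pderivC a l oU (sphi k) Uy.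
rewrite JC; congr *%R.
by apply: eq_bigr => s sr; rewrite !iconsS isubst_neq.
Qed.

End Pullback.

Section ExteriorDerivative.
Variables (R : realType) (n : nat) (M : smooth_manifold R n).
Local Notation idx p := {ffun 'I_p -> 'I_n}.
Implicit Types (i j : chart_index M) (x : M).

Lemma chart_overlap_open i j : open (chart i @` (chart_dom i `&` chart_dom j)).
Proof.
rewrite openE => y [x [xi xj] <-]; rewrite /interior.
have nI : nbhs (chart i x) (chart i @` chart_dom i).
  by apply: open_nbhs_nbhs; split; [exact: chart_img_open | exists x].
have nJ : nbhs (chart i x) (chart_inv i @^-1` chart_dom j).
  apply: (chart_inv_continuous (chart_img xi)); rewrite chartK//.
  by apply: open_nbhs_nbhs; split; [exact: chart_dom_open|].
by apply: filterS2 nI nJ => _ [z zi <-] /=; rewrite chartK// => zj; exists z.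
Qed.

Lemma smooth_in_chart_lin i (a : R) (f1 f2 : M -> R) :
  smooth_in_chart i f1 -> smooth_in_chart i f2 ->
  smooth_in_chart i (fun x => a * f1 x + f2 x).
Proof. by move=> s1 s2; exact: (smooth_on_lin (@chart_img_open _ _ _ i) a s1 s2). Qed.

Definition zero_ctensor p : ctensor M p.
Proof.
refine (@CTensor R n M p (fun _ _ _ => 0) _ _).
  by move=> i b; exact: smooth_on0.
by move=> i j x xi xj b; rewrite big1// => c _; rewrite mulr0.
Defined.

Definition sub_ctensor p (S T : ctensor M p) : ctensor M p.
Proof.
refine (@CTensor R n M p (fun i b x => S i b x - T i b x) _ _).
  move=> i b; rewrite (_ : (fun x => _) = (fun x => -1 * T i b x + S i b x)).
    by apply: smooth_in_chart_lin; exact: ctensor_smooth.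
  by apply/funext => x; rewrite mulN1r addrC.
move=> i j x xi xj b; rewrite (ctensor_law S xi xj) (ctensor_law T xi xj) -sumrB.
by apply: eq_bigr => c _; rewrite mulrBr.
Defined.

(** With weight-one antisymmetrization this is $dh$ divided by q + 1. It is built from partial
    derivatives, so its smoothness and transformation law do not involve the metric. *)
Definition exterior_comp q (h : ctensor M q) : components M q.+1 := fun i b x =>
  antisym (fun c : idx q.+1 => dcoord i (c ord0) (h i (itail c)) x) b.

Lemma exterior_comp_law q (h : ctensor M q) i j x : chart_dom i x -> chart_dom j x ->
  forall b, exterior_comp h i b x =
    \sum_(c : idx q.+1) (\prod_(k < q.+1) Defs.jacobian i j x (c k) (b k)) * exterior_comp h j c x.
Proof.
move=> xi xj b.
have oU := @chart_overlap_open i j.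
have xU : (chart i @` (chart_dom i `&` chart_dom j)) (chart i x) by exists x.
have phix : chart j (chart_inv i (chart i x)) = chart j x by rewrite chartK.
rewrite /exterior_comp /dcoord.
rewrite (@antisym_pderiv_pullback _ _ _ _ (fun y => chart j (chart_inv i y))
  (fun c => h i c \o chart_inv i) (fun c => h j c \o chart_inv j) _ _ oU xU).
- by rewrite phix.
- by move=> k; exact: chart_transition.
- move=> _ [z [zi zj] <-] c /=; rewrite !chartK// (ctensor_law h zi zj).
  by [].
- move=> c; rewrite phix.
  have : nbhs (chart j x) (chart j @` chart_dom j).
    by apply: open_nbhs_nbhs; split; [exact: chart_img_open | exists x].
  have sh : smooth_in_chart j (h j c) by exact: ctensor_smooth.
  by apply: filterS => z zj k; apply: smooth_on_derivable sh zj.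
- move=> c k; rewrite phix.
  have sh : smooth_in_chart j (h j c) by exact: ctensor_smooth.
  by have [] := sh [:: k] _ (chart_img xj).
Qed.

Definition exterior_ctensor (a : R) q (h : ctensor M q) : ctensor M q.+1.
Proof.
refine (@CTensor R n M q.+1 (fun i b x => a * exterior_comp h i b x) _ _).
  move=> i b; rewrite (_ : (fun x => _) = (fun x => \sum_(s : 'S_q.+1)
      (a * ((q.+1)`!%:R^-1 * (-1) ^+ s)) *
      dcoord i (iperm b s ord0) (h i (itail (iperm b s))) x)).
    apply: (@smooth_on_sum _ _ _ (@chart_img_open _ _ _ i) _ xpredT) => s.
    exact/smooth_dcoord/ctensor_smooth.
  apply/funext => x; rewrite /exterior_comp /antisym !mulr_sumr.
  by apply: eq_bigr => s _; rewrite !mulrA.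
move=> i j x xi xj b; rewrite (exterior_comp_law h xi xj) mulr_sumr.
by apply: eq_bigr => c _; rewrite mulrCA.
Defined.

End ExteriorDerivative.

(** * The decomposition *)

Section Decomposition.
Variables (R : realType) (n : nat) (M : smooth_manifold R n) (g : metric_tensor M).
Local Notation idx p := {ffun 'I_p -> 'I_n}.
Local Notation G i x := (fun a b => gdown g i a b x).
Local Notation regular i := (@derivable_in_chart R n M i).
Implicit Types (i : chart_index M) (x : M).

(** Given skewness in the later slots, any of their entries can be brought to the second slot,
    exchanged with the first, and moved back. This fits the conformal Killing-Yano equation, which
    only symmetrizes the first two indices. *)
Lemma skewsym_icons2 p (F : idx p.+2 -> R) :
  (forall a, skewsym (fun b => F (icons a b))) ->
  (forall a b1 (b : idx p), F (icons b1 (icons a b)) = - F (icons a (icons b1 b))) ->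
  skewsym F.
Proof.
move=> skF F2; apply: skewsym_icons => // a b r; rewrite -[b]icons_itail.
set b1 := b ord0; set c := itail b; case: (unliftP ord0 r) => [s|] ->.
  have swap a' b' b1' : F (icons a' (icons b' (isubst c s b1'))) =
      - F (icons a' (icons b1' (isubst c s b'))).
    rewrite -(skewsym_tperm _ (skF a') (neq_lift ord0 s)) iperm_icons_tperm0.
    by rewrite isubst_same isubst_isubst.
  by rewrite iconsS isubst_iconsS swap F2 opprK swap isubst_id.
by rewrite icons0 isubst_icons0 F2.
Qed.

Lemma g_wedgeE q (h : ctensor M q) i a b1 (b : idx q) x :
  skew_symmetric h -> chart_dom i x ->
  g_wedge g h i a (icons b1 b) x =
  2 * q.+1%:R^-1 * wedge (G i x) (fun b => h i b x) a b1 b.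
Proof.
move=> skh xi; rewrite /g_wedge.
by rewrite (antisym_wedge (fun c => gdown g i a c x) b1 b (skh i x xi)) mulrA.
Qed.

Lemma ricci_curvature_constant lam p (T : components M p) i k l (b : idx p) x :
  curvature_constant g lam -> chart_dom i x -> (forall b, smooth_in_chart i (T i b)) ->
  nabla g (nabla g T) i (icons k (icons l b)) x -
  nabla g (nabla g T) i (icons l (icons k b)) x =
  lam * \sum_r (gdown g i (b r) k x * T i (isubst b r l) x
                - gdown g i (b r) l x * T i (isubst b r k) x).
Proof.
move=> curv xi sT; rewrite ricci_identity// mulr_sumr -sumrN; apply: eq_bigr => r _.
under eq_bigr => e _ do
  rewrite (riemann_up_curvature _ _ _ _ curv xi) -mulrA mulrBl -!mulrA.
rewrite -mulr_sumr sumrB (bigD1 k)//= eqxx mul1r big1 ?addr0 => [|e /negPf->]; last first.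
  by rewrite mul0r.
rewrite (bigD1 l)//= eqxx mul1r [X in _ - (_ + X)]big1 ?addr0 => [|e /negPf->]; last first.
  by rewrite mul0r.
by rewrite -mulrN opprB.
Qed.

Lemma skew_nabla_h lam q (Y : ctensor M q.+1) (h : ctensor M q) i x :
  curvature_constant g lam -> conformal_killing_yano_with g Y h -> (q.+1 < n)%N ->
  chart_dom i x -> skewsym (fun b => nabla g h i b x).
Proof.
move=> curv [skY skh cky] qn xi; set w : R := 2 * q.+1%:R^-1.
have w0 : w != 0 by rewrite mulf_neq0 ?invr_eq0 ?pnatr_eq0.
(* The conformal Killing-Yano equation says exactly that [K] is skew in its first two indices;
   skewness in the others comes from [Y] and the antisymmetrization. *)
pose K : components M q.+2 := fun i b x =>
  nabla g Y i b x - g_wedge g h i (b ord0) (itail b) x.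
have sY b : smooth_in_chart i (Y i b) by exact: ctensor_smooth.
have rY b : regular i (Y i b) by exact: smooth_derivable_in_chart.
have rh b : regular i (h i b) by exact/smooth_derivable_in_chart/ctensor_smooth.
have rdY b : regular i (nabla g Y i b).
  by apply: nabla_regular => c; exact: ctensor_smooth.
have skK z : chart_dom i z -> skewsym (fun b => K i b z).
  move=> zi; apply: skewsym_icons2 => [a b s|a b1 b].
    rewrite /K !icons0 !itail_icons mulrBr; congr (_ - _).
      exact: (@nabla_skewsym R n M g i _ Y a z zi rY (fun z zi => skY i z zi) b s).
    by rewrite /g_wedge [RHS]mulrCA antisym_skewsym.
  rewrite /K !icons0 !itail_icons; have := cky i z zi a b1 b; move/eqP.
  rewrite -subr_eq0 => /eqP e; apply/eqP; rewrite -subr_eq0 opprK -[X in _ == X]e.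
  by apply/eqP; ring.
pose W : components M q.+2 := fun i (c : idx q.+2) x => wedge (G i x)
  (fun b => h i b x) (c ord0) (c (lift ord0 ord0)) (itail (itail c)).
have rW b : regular i (W i b).
  apply: derivable_in_chartB; first by apply: derivable_in_chartM => //; exact: gdown_regular.
  by apply: derivable_in_chart_sum => r; apply: derivable_in_chartM => //; exact: gdown_regular.
have KE z : chart_dom i z -> forall b, K i b z = nabla g Y i b z - w * W i b z.
  move=> zi b; rewrite /K -[itail b]icons_itail g_wedgeE//.
  by rewrite /W ffunE.
have rK b : regular i (K i b).
  apply: (@eq_derivable_in_chart R n M i (fun z => nabla g Y i b z - w * W i b z)) => [z zi|].
    by rewrite KE.
  by apply: derivable_in_chartB => //; exact: derivable_in_chartZ.
(* The decomposition of $\nabla Y$ differentiated once more. The factor [w] stays attached to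
   $\nabla h$, to match [Dh] in the commutator lemma, and is cancelled at the end. *)
have nablaK c a b1 b : nabla g K i (icons c (icons a (icons b1 b))) x +
    wedge (G i x) (fun b => w * nabla g h i (icons c b) x) a b1 b =
    nabla g (nabla g Y) i (icons c (icons a (icons b1 b))) x.
  rewrite (@eq_nabla _ _ _ g i _ K (fun i b z => nabla g Y i b z - w * W i b z) x _ xi KE).
  rewrite (@nablaB R n M g i _ (nabla g Y) (fun i b z => w * W i b z) x _ xi rdY); last first.
    by move=> d; exact: derivable_in_chartZ.
  rewrite (@nablaZ R n M g i _ W w x _ xi rW) (@nabla_wedge R n M g i q h c a b1 b x xi rh).
  rewrite /wedge mulrBr mulrCA mulr_sumr.
  under eq_bigr => r _ do rewrite mulrCA.
  by rewrite subrK.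
have altDh c : skewsym (fun b => w * nabla g h i (icons c b) x).
  move=> b s; rewrite mulrCA; congr (_ * _).
  exact: (@nabla_skewsym R n M g i _ h c x xi rh (fun z zi => skh i z zi) b s).
apply: skewsym_icons => [a|a b r].
  exact: (@nabla_skewsym R n M g i _ h a x xi rh (fun z zi => skh i z zi)).
apply: (mulfI w0); rewrite mulrN.
apply: (@skew_of_commutator R n (G i x) (fun a b => gup g i a b x) _ _ _ q lam
  (fun b => Y i b x) (fun c b => nabla g K i (icons c b) x)
  (fun c b => w * nabla g h i (icons c b) x)) => //.
- by move=> *; exact: gdown_sym.
- by move=> *; exact: gup_sym.
- by move=> *; exact: gup_gdown.
- exact: skY.
- by move=> c; exact: nabla_skewsym.
- move=> c d b1 b'; have E := ricci_curvature_constant c d (icons b1 b') curv xi sY.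
  exact: etrans (congr2 (fun u v => u - v) (nablaK c d b1 b') (nablaK d c b1 b')) E.
Qed.

(** This makes $\nabla h$, up to a constant, a closed conformal Killing-Yano tensor associated with
    [h] itself; the Ricci identity provides the commutator and total skewness of $\nabla h$ does the
    rest. *)
Lemma nabla_nabla_h lam q (h : ctensor M q) i c a (b : idx q) x :
  curvature_constant g lam -> (0 < q)%N -> skew_symmetric h ->
  (forall z, chart_dom i z -> skewsym (fun b => nabla g h i b z)) -> chart_dom i x ->
  nabla g (nabla g h) i (icons c (icons a b)) x =
  - lam * wedge (G i x) (fun b => h i b x) c a b.
Proof.
move=> curv q0 skh skdh xi.
have sh b' : smooth_in_chart i (h i b') by exact: ctensor_smooth.
apply: (@wedge_of_commutator R n (G i x) _ q lam (fun b => h i b x)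
  (fun c b => nabla g (nabla g h) i (icons c b) x)) => //.
- by move=> *; exact: gdown_sym.
- exact: skh.
- by move=> d; apply: nabla_skewsym => // b'; exact: nabla_regular.
- by move=> d e b'; rewrite (ricci_curvature_constant _ _ _ curv xi).
Qed.

(* The connection is torsion-free, so the Christoffel symbols drop out. *)
Lemma antisym_nabla q (h : ctensor M q) i (b : idx q.+1) x : chart_dom i x ->
  antisym (fun c => nabla g h i c x) b = exterior_comp h i b x.
Proof.
move=> xi; rewrite /exterior_comp /nabla antisymD antisymN antisym_sum big1 ?subr0// => r _.
rewrite antisym_sum big1// => e _.
apply: (@antisym_eq0 _ _ _ _ _ ord0 (lift ord0 r)); first exact: neq_lift.
move=> c; rewrite -[c]icons_itail iperm_icons_tperm0 !icons0 !itail_icons.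
by rewrite isubst_same isubst_isubst christoffel_sym.
Qed.

End Decomposition.

Theorem theorem2 (R : realType) (n : nat) (M : smooth_manifold R n)
    (g : metric_tensor M) (lam : R) (q : nat) (Y : ctensor M q.+1)
    (M_sym : maximally_symmetric g) (lam_neq0 : lam != 0)
    (M_curv : curvature_constant g lam)
    (q_ge : (2 <= q.+1)%N) (Y_cky : conformal_killing_yano g Y) :
  exists A H : ctensor M q.+1,
    [/\ killing_yano g A, closed_conformal_killing_yano g H &
        forall i x, chart_dom i x -> forall b, Y i b x = A i b x + H i b x].
Proof.
have zero_wedge i a b x : g_wedge g (zero_ctensor M q) i a b x = 0.
  rewrite /g_wedge /antisym big1 ?mulr0// => s _; by rewrite mulr0 mulr0.
have [h hY] := Y_cky; have [skY skh cky] := hY.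
(* For n at most p, the antisymmetrized $\nabla Y$ has p + 1 > n skew indices and vanishes, so H = Y
   and A = 0 will do. *)
have [nq|qn] := leqP n q.+1.
  exists (zero_ctensor M q.+1), Y; split.
  - exists (zero_ctensor M q); split=> //; split.
    + by move=> i x xi b s; rewrite mulr0.
    + by move=> i x xi b s; rewrite mulr0.
    + move=> i x xi a b1 b; rewrite !zero_wedge /nabla !dcoord_cst.
      by rewrite !big1 ?subr0 ?addr0// => r _; rewrite big1// => c _; rewrite mulr0.
  - split=> // i x xi ab; apply: skewsym_eq0; last by rewrite ltnS.
    exact: antisym_skewsym.
  - by move=> i x xi b; rewrite add0r.
set w : R := 2 * q.+1%:R^-1.
have q0 : (0 < q)%N by [].
have skdh i x : chart_dom i x -> skewsym (fun b => nabla g h i b x).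
  by move=> xi; exact: skew_nabla_h M_curv hY qn xi.
(* The constant is chosen so that $\nabla\nabla h = -\lambda W[h]$ becomes $\nabla H = w\,W[h]$, the
   non-skew part of $\nabla Y$. *)
pose H := exterior_ctensor (- (w / lam)) h; pose A := sub_ctensor Y H.
have AE i x b : A i b x = Y i b x - H i b x by [].
have HE i x b : chart_dom i x -> H i b x = - (w / lam) * nabla g h i b x.
  by move=> xi; rewrite /H /= -(antisym_nabla g _ _ xi) skewsym_antisym//; exact: skdh.
have skH : skew_symmetric H.
  by move=> i x xi b s; rewrite !HE// (skdh i x xi) mulrCA.
have nablaH i x c a (b : {ffun 'I_q -> 'I_n}) : chart_dom i x ->
    nabla g H i (icons c (icons a b)) x = g_wedge g h i c (icons a b) x.
  move=> xi; rewrite (@eq_nabla _ _ _ g i _ H (fun i b z => - (w / lam) * nabla g h i b z) x _ xi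
    (fun z zi d => HE i z d zi)) nablaZ//; last first.
    by move=> d; apply: nabla_regular => e; exact: ctensor_smooth.
  rewrite (nabla_nabla_h _ _ _ M_curv q0 skh (skdh i) xi) g_wedgeE// -/w mulrA.
  by congr (_ * _); rewrite mulrNN divfK.
have nablaA i x ab : chart_dom i x ->
    nabla g A i ab x = nabla g Y i ab x - nabla g H i ab x.
  by move=> xi; apply: nablaB => // b; exact/smooth_derivable_in_chart/ctensor_smooth.
exists A, H; split.
(* The tensors [Y] and [H] share the associated form [h], so the difference [A] has associated form
   zero. *)
- exists (zero_ctensor M q); split=> //; split.
  + by move=> i x xi b s; rewrite !AE (skY i x xi) (skH i x xi) mulrBr.
  + by move=> i x xi b s; rewrite mulr0.
  + move=> i x xi a b1 b; rewrite !zero_wedge !nablaA// !nablaH// addrACA -opprD.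
    by rewrite cky// addr0 subrr.
- split.
    by exists h; split=> // i x xi a b1 b; rewrite !nablaH.
  move=> i x xi ab.
  (* All of $\nabla H$ is a wedge with the metric, which antisymmetrization over every index
     annihilates. *)
  rewrite (@eq_antisym _ _ _ _ (fun c => w * wedge (fun a b => gdown g i a b x)
    (fun b => h i b x) (c ord0) (c (lift ord0 ord0)) (itail (itail c)))); last first.
    move=> c; rewrite -{1}[c]icons_itail -{1}[itail c]icons_itail nablaH// g_wedgeE//.
    by rewrite ffunE.
  by rewrite antisymZ antisym_sym_wedge ?mulr0// => a b; exact: gdown_sym.
- by move=> i x xi b; rewrite AE subrK.
Qed.
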